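(* Consider the independent block-fading binary symmetric wiretap channel with parameters $q_1,q_1^*\in[0,1]$, $q_2=1-q_1$, $q_2^*=1-q_1^*$, and crossover probabilities satisfying $p_1\le p_2\le p_1^*\le p_2^*\le 0.5$. Its secrecy capacity with channel state information available only at the decoders is $$C^s_{\textrm{CSI-D}}= q_1^*H(p_1^* )+q_2^*H(p_2^* )-q_1H(p_1)-q_2H(p_2).$$
   Context: $H(p)=-p\log_2 p-(1-p)\log_2(1-p)$ is the binary entropy function, and BSC$(p)$ denotes the binary symmetric channel with crossover probability $p$. Independent block-fading binary symmetric wiretap channel: the transmitter sends $NB$ binary symbols $X_{1:NB}$ organized in $B$ fading blocks of length $N$. Each block $k$ has a main-channel state $S_k\in\{1,2\}$ with $\Pr(S_k=1)=q_1$ and an eavesdropper-channel state $S^*_k\in\{1,2\}$ with $\Pr(S_k^*=1)=q_1^*$; all these states are mutually independent (across blocks and between the two channels) and constant within a block. Within block $k$, the legitimate receiver observes the output $Y$ of $N$ independent uses of BSC$(p_{S_k})$, and the eavesdropper observes the output $Z$ of $N$ independent uses of BSC$(p^*_{S^*_k})$. Let $\mathsf{S}$ denote all the state realizations $(S_k,S_k^* )_{k=1}^B$. A code consists of a (possibly randomized) encoder $X_{1:NB}=f(\mathsf{M})$ of a uniformly distributed message $\mathsf{M}$, which knows only the state distributions (not the realizations), and a decoder $\hat{\mathsf{M}}=g(Y_{1:NB},\mathsf{S})$; its rate is $\frac{1}{NB}\log_2$ of the message-set size. A rate $R$ is achievable if there are such codes of rate at least $R$ (asymptotically) with $N,B\to\infty$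 such that $\Pr\{\mathsf{M}\ne\hat{\mathsf{M}}\}\to0$ and $\frac{1}{NB}I(\mathsf{M};Z_{1:NB}\mid\mathsf{S})\to 0$. $C^s_{\textrm{CSI-D}}$ is the supremum of achievable rates. *)

(* Defs.v *)
From HB Require Import structures.
From mathcomp Require Import all_boot all_order all_algebra.
From mathcomp Require Import all_classical all_reals all_analysis.
Set Implicit Arguments. Unset Strict Implicit. Unset Printing Implicit Defensive.
Import Order.TTheory GRing.Theory Num.Theory.
Local Open Scope ring_scope.

Section BFWiretap.
Variable R : realType.

Definition log2 (x : R) : R := ln x / ln 2.

Definition xlog2x (x : R) : R := if x == 0 then 0 else x * log2 x.

Definition H2 (p : R) : R := - xlog2x p - xlog2x (1 - p).

Definition bsc (p : R) (x y : bool) : R := if x == y then 1 - p else p.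

(* A block of N binary symbols for each of the B fading blocks:
   position (k, i) = i-th symbol of block k.  X_{1:NB}, Y_{1:NB}, Z_{1:NB}. *)
Definition word (N B : nat) := {ffun 'I_B * 'I_N -> bool}.

(* State realizations S = (S_k, S*_k)_k; a component [true] means state 1,
   [false] means state 2. *)
Definition states (B : nat) := {ffun 'I_B -> bool * bool}.

Variables (p1 p2 ps1 ps2 q1 qs1 : R).

Definition pmain (s : bool) : R := if s then p1 else p2.
Definition peve (s : bool) : R := if s then ps1 else ps2.

Definition Pstate B (s : states B) : R :=
  \prod_(k < B) ((if (s k).1 then q1 else 1 - q1) *
                 (if (s k).2 then qs1 else 1 - qs1)).

Definition Wmain N B (s : states B) (x y : word N B) : R :=
  \prod_(t : 'I_B * 'I_N) bsc (pmain (s t.1).1) (x t) (y t).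
Definition Weve N B (s : states B) (x z : word N B) : R :=
  \prod_(t : 'I_B * 'I_N) bsc (peve (s t.1).2) (x t) (z t).

(* A code with message set 'I_M: a randomized encoder (a probability
   distribution on codewords for each message, independent of the state
   realizations) and a decoder using Y_{1:NB} and all the states. *)
Record code (N B M : nat) := Code {
  enc : 'I_M -> word N B -> R;
  dec : word N B -> states B -> 'I_M }.

Definition valid_code N B M (c : code N B M) : Prop :=
  (forall m x, 0 <= enc c m x) /\ (forall m, \sum_(x : word N B) enc c m x = 1).

Definition err_prob N B M (c : code N B M) : R :=
  \sum_(m : 'I_M) \sum_(s : states B) \sum_(x : word N B) \sum_(y : word N B)
    (M%:R^-1 * Pstate s * enc c m x * Wmain s x y *
       (if dec c y s != m then 1 else 0)).

Definition PMZ N B M (c : code N B M) (s : states B) (m : 'I_M) (z : word N B) : R :=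
  M%:R^-1 * \sum_(x : word N B) enc c m x * Weve s x z.

Definition PZ N B M (c : code N B M) (s : states B) (z : word N B) : R :=
  \sum_(m : 'I_M) PMZ c s m z.

Definition MI_given N B M (c : code N B M) (s : states B) : R :=
  \sum_(m : 'I_M) \sum_(z : word N B)
    (if PMZ c s m z == 0 then 0
     else PMZ c s m z * log2 (PMZ c s m z / (M%:R^-1 * PZ c s z))).

Definition leakage N B M (c : code N B M) : R :=
  \sum_(s : states B) Pstate s * MI_given c s.

Definition rate N B M : R := log2 M%:R / (N * B)%:R.

Definition achievable (r : R) : Prop :=
  forall eps : R, 0 < eps -> forall N0 B0 : nat,
    exists (N B M : nat) (c : code N B M),
      [/\ (N0 <= N)%N, (B0 <= B)%N, (0 < M)%N, valid_code c &
      [/\ r - eps <= rate N B M, err_prob c <= eps &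
          leakage c / (N * B)%:R <= eps]].

Definition is_secrecy_capacity (C : R) : Prop :=
  (forall r, achievable r -> r <= C) /\
  (forall C', (forall r, achievable r -> r <= C') -> C <= C').

End BFWiretap.

(* Main.v *)
Require Import Defs.
From mathcomp Require Import all_boot all_order all_algebra.
From mathcomp Require Import all_classical all_reals all_analysis.
From mathcomp Require Import ring lra.
Import Order.TTheory GRing.Theory Num.Theory.
Local Open Scope ring_scope.

(* Let h and h' be the mean entropies of the main and eavesdropper noise, so that
   C = h' - h. Converse: given the states the eavesdropper's channel is a degraded
   version of the main one, hence I(M;Y) - I(M;Z) <= I(X;Y) - I(X;Z) <=
   H(Z|X) - H(Y|X), whose mean per symbol is h' - h; Fano's inequality and the
   leakage constraint conclude. Achievability: a random codebook indexed by a
   message and a uniform random index is decoded by thresholding the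
   likelihood of the received word. With about 2^(n(1-h')) random indices per
   message, the eavesdropper could recover the index if told the message, so
   H(Z|M) is close to n and the leakage per symbol vanishes; averaging over
   the codebook handles both decoders at once. *)

Set Implicit Arguments. Unset Strict Implicit. Unset Printing Implicit Defensive.

(** Every entropy inequality below is an instance of log x <= (x - 1) / ln 2, packaged once in
    [jensen_log2]. The special feature of binary symmetric noise is that its transition matrices
    have columns as well as rows summing to one: further noise never lowers the output entropy, so
    H(Y) <= H(Z) for every code, and a uniform codeword produces a uniform received word. The same
    column sums leave, for each received word, at most 1 / tau words whose likelihood reaches tau,
    so thresholding works without typical sets. The obstacle is that the encoder ignores the states:
    one codebook and one threshold, placed at the mean entropy, must serve all of them. Hence
    failure probabilities are averaged over the states before a codebook is chosen, and the
    fluctuation of the states across blocks is part of the atypical event, so that B has to grow.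
    Secrecy is measured per symbol, so it suffices that the eavesdropper's error on the index tends
    to 0: the loss in Fano's inequality is then o(n). *)

Section Logarithm.
Variable R : realType.
Implicit Types x y : R.

Lemma ln2_gt0 : 0 < ln 2 :> R.
Proof. by rewrite ln_gt0// ltr1n. Qed.

Lemma log2_1 : log2 1 = 0 :> R.
Proof. by rewrite /log2 ln1 mul0r. Qed.

Lemma log2_2 : log2 2 = 1 :> R.
Proof. by rewrite /log2 divff// gt_eqF// ln2_gt0. Qed.

Lemma log2M x y : 0 < x -> 0 < y -> log2 (x * y) = log2 x + log2 y.
Proof. by move=> x0 y0; rewrite /log2 lnM ?posrE// mulrDl. Qed.

Lemma log2V x : 0 < x -> log2 x^-1 = - log2 x.
Proof. by move=> x0; rewrite /log2 lnV ?posrE// mulNr. Qed.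

Lemma log2_div x y : 0 < x -> 0 < y -> log2 (x / y) = log2 x - log2 y.
Proof. by move=> x0 y0; rewrite log2M ?invr_gt0// log2V. Qed.

Lemma ler_log2 x y : 0 < x -> x <= y -> log2 x <= log2 y.
Proof.
move=> x0 xy; rewrite /log2 ler_pM2r ?invr_gt0 ?ln2_gt0//.
by rewrite ler_ln ?posrE// (lt_le_trans x0).
Qed.

Lemma log2_ge0 x : 1 <= x -> 0 <= log2 x.
Proof. by move=> x1; rewrite -log2_1 ler_log2. Qed.

Lemma log2_prod (I : finType) (F : I -> R) :
  (forall i, 0 < F i) -> log2 (\prod_i F i) = \sum_i log2 (F i).
Proof.
move=> F0; pose K (a b : R) : Prop := 0 < a /\ log2 a = b.
suff [] : K (\prod_i F i) (\sum_i log2 (F i)) by [].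
apply: (big_ind2 K); first by split; [exact: ltr01|exact: log2_1].
- by move=> a b c d [a0 <-] [c0 <-]; split; [exact: mulr_gt0|exact: log2M].
- by move=> i _; split.
Qed.

Lemma log2_powR (a : R) : log2 (2 `^ a) = a.
Proof. by rewrite /log2 ln_powR mulfK// gt_eqF// ln2_gt0. Qed.

(** Take k to be the integer part of 2^a: the k competitors of a given index stay below 2^a, while k
    + 1 indices reach the exponent a. A negative a gives k = 0 and a single index, so the size is
    never zero. *)
Lemma exists_size (a : R) :
  exists2 k : nat, k%:R <= 2 `^ a & a <= log2 k.+1%:R.
Proof.
exists (Num.truncn (2 `^ a)); first by rewrite truncn_le ltW// powR_gt0.
by rewrite -[leLHS]log2_powR ler_log2 ?powR_gt0// ltW// truncnS_gt.
Qed.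

Lemma xlog2xE x : xlog2x x = x * log2 x.
Proof. by rewrite /xlog2x; case: eqP => // ->; rewrite mul0r. Qed.

Lemma log2_le_sub1 x : 0 < x -> log2 x <= (x - 1) / ln 2.
Proof.
move=> x0; rewrite /log2 ler_pM2r ?invr_gt0 ?ln2_gt0//.
by have := @le_ln1Dx R (x - 1); rewrite addrCA subrr addr0; apply; lra.
Qed.

End Logarithm.

(** * Entropy inequalities on finite sets *)

Section Information.
Variable R : realType.

(** Concavity of the logarithm, for masses that may have any total. The second mass enters only
    through [P a * r a <= Q a], which lets [Q] charge points where [P] vanishes. *)
Lemma jensen_log2 (A : finType) (P r Q : A -> R) :
  (forall a, 0 <= P a) -> (forall a, 0 < P a -> 0 < r a) ->
  (forall a, P a * r a <= Q a) -> \sum_a Q a <= \sum_a P a ->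
  \sum_a P a * log2 (r a) <= 0.
Proof.
move=> P0 r0 PrQ QP.
apply: (@le_trans _ _ (\sum_a (Q a - P a) / ln 2)).
  apply: ler_sum => a _; have := P0 a; rewrite le_eqVlt => /orP[/eqP Pa|Pa].
    have := PrQ a; rewrite -Pa !mul0r subr0 => Qa.
    by rewrite divr_ge0// ltW// ln2_gt0.
  apply: (@le_trans _ _ (P a * ((r a - 1) / ln 2))).
    by rewrite ler_pM2l// log2_le_sub1// r0.
  rewrite mulrA ler_pM2r ?invr_gt0 ?ln2_gt0//.
  by rewrite mulrBr mulr1 lerD2r.
rewrite -mulr_suml sumrB -oppr_ge0 -mulNr divr_ge0 ?(ltW (ln2_gt0 _))//.
by rewrite opprB subr_ge0.
Qed.

(** Shannon entropy in bits with the sign reversed. The factor [P a] makes terms of mass zero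
    vanish, whatever [log2] returns there. *)
Definition neg_entropy (A : finType) (P : A -> R) : R := \sum_a P a * log2 (P a).

Definition output (A B : finType) (P : A -> R) (W : A -> B -> R) (b : B) : R :=
  \sum_a P a * W a b.

Definition stochastic (A B : finType) (W : A -> B -> R) :=
  (forall a b, 0 <= W a b) /\ (forall a, \sum_b W a b = 1).

Lemma output_ge0 (A B : finType) (P : A -> R) (W : A -> B -> R) b :
  (forall a, 0 <= P a) -> (forall a b, 0 <= W a b) -> 0 <= output P W b.
Proof. by move=> P0 W0; apply: sumr_ge0 => a _; rewrite mulr_ge0. Qed.

Lemma output_gt0 (A B : finType) (P : A -> R) (W : A -> B -> R) a b :
  (forall a, 0 <= P a) -> (forall a b, 0 <= W a b) ->
  0 < P a -> 0 < W a b -> 0 < output P W b.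
Proof.
move=> P0 W0 Pa Wab; rewrite /output (bigD1 a)//=.
rewrite ltr_wpDr ?mulr_gt0//.
by apply: sumr_ge0 => *; rewrite mulr_ge0.
Qed.

Lemma sum_output (A B : finType) (P : A -> R) (W : A -> B -> R) :
  stochastic W -> \sum_b output P W b = \sum_a P a.
Proof.
move=> [_ W1]; rewrite exchange_big/=; apply: eq_bigr => a _.
by rewrite -mulr_sumr W1 mulr1.
Qed.

Lemma output_comp (A B C : finType) (P : A -> R) (W : A -> B -> R)
    (V : B -> C -> R) c :
  output (output P W) V c = output P (fun a => output (W a) V) c.
Proof.
rewrite /output; under eq_bigr do rewrite mulr_suml.
rewrite exchange_big/=; apply: eq_bigr => a _; rewrite mulr_sumr.
by apply: eq_bigr => b _; rewrite mulrA.
Qed.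

Lemma stochastic_output (A B C : finType) (W : A -> B -> R) (V : B -> C -> R) :
  stochastic W -> stochastic V -> stochastic (fun a => output (W a) V).
Proof.
move=> [W0 W1] [V0 V1]; split=> [a b|a]; first exact: output_ge0.
by rewrite sum_output// W1.
Qed.

(** Jensen under the joint mass [P a * V a b], for the ratio [output P V b / P a]. The dominating
    mass [output P V b * V a b] has the right total because the columns of [V] sum to one. *)
Lemma neg_entropy_doubly_stochastic (A : finType) (P : A -> R) (V : A -> A -> R) :
  (forall a, 0 <= P a) -> stochastic V -> (forall b, \sum_a V a b = 1) ->
  neg_entropy (output P V) <= neg_entropy P.
Proof.
move=> P0 [V0 V1] V1'.
have := @jensen_log2 (A * A)%type (fun u => P u.1 * V u.1 u.2)
  (fun u => output P V u.2 / P u.1) (fun u => output P V u.2 * V u.1 u.2).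
rewrite -!(pair_bigA _ (fun a b => P a * V a b))/=.
rewrite -!(pair_bigA _ (fun a b => output P V b * V a b))/=.
rewrite -!(pair_bigA _ (fun a b => P a * V a b * log2 (output P V b / P a)))/=.
have PV0 a b : 0 < P a * V a b -> 0 < P a /\ 0 < V a b.
  move=> h; split; rewrite lt_neqAle ?P0 ?V0 andbT eq_sym.
    by apply: contraTneq h => ->; rewrite mul0r ltxx.
  by apply: contraTneq h => ->; rewrite mulr0 ltxx.
have -> : \sum_a \sum_b P a * V a b * log2 (output P V b / P a) =
          neg_entropy (output P V) - neg_entropy P.
  transitivity (\sum_a \sum_b (P a * V a b * log2 (output P V b) -
                  P a * V a b * log2 (P a))).
    apply: eq_bigr => a _; apply: eq_bigr => b _; rewrite -mulrBr.
    have : 0 <= P a * V a b by rewrite mulr_ge0.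
    rewrite le_eqVlt => /orP[/eqP <-|/PV0[Pa Vab]]; first by rewrite !mul0r.
    by rewrite log2_div// (output_gt0 (a := a)).
  under eq_bigr do rewrite sumrB.
  rewrite sumrB exchange_big/=; congr (_ - _).
    by apply: eq_bigr => b _; rewrite -mulr_suml.
  by apply: eq_bigr => a _; rewrite -mulr_suml -mulr_sumr V1 mulr1.
rewrite subr_le0; apply.
- by move=> u; rewrite mulr_ge0.
- move=> [a b]/= /PV0[Pa Vab]; rewrite divr_gt0//.
  exact: (output_gt0 (a := a)).
- move=> [a b]/=; have := P0 a; rewrite le_eqVlt => /orP[/eqP <-|Pa].
    by rewrite !mul0r mulr_ge0// output_ge0.
  by rewrite mulrAC mulrCA divff ?gt_eqF// mulr1.
- rewrite exchange_big/=.
  under eq_bigr do rewrite -mulr_sumr V1' mulr1.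
  by under [leRHS]eq_bigr do rewrite -mulr_sumr V1 mulr1; rewrite sum_output.
Qed.

(** The data-processing inequality I(A;C) <= I(A;B), rearranged as a comparison of entropy
    differences. In the converse A is the codeword, B and C the two received words. *)
Lemma neg_entropy_data_processing (A B C : finType) (P : A -> R) (W : A -> B -> R)
    (V : B -> C -> R) :
  (forall a, 0 <= P a) -> stochastic W -> stochastic V ->
  neg_entropy (output P W) - neg_entropy (output (output P W) V) <=
  \sum_a P a * (neg_entropy (W a) - neg_entropy (output (W a) V)).
Proof.
move=> P0 [W0 W1] [V0 V1].
set PB := output P W; set PC := output PB V; pose U a := output (W a) V.
have PB0 b : 0 <= PB b by exact: output_ge0.
have PC0 c : 0 <= PC c by exact: output_ge0.
have U0 a c : 0 <= U a c by exact: output_ge0.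
pose T : finType := (A * (B * C))%type.
pose J (u : T) := P u.1 * W u.1 u.2.1 * V u.2.1 u.2.2.
pose r (u : T) := (U u.1 u.2.2 * PB u.2.1) / (W u.1 u.2.1 * PC u.2.2).
(* [Q] is the law in which B is redrawn from C through the backward channel, so that B depends on A
   only through C. *)
pose Q (u : T) := P u.1 * U u.1 u.2.2 * (PB u.2.1 * V u.2.1 u.2.2 / PC u.2.2).
have sumT (F : A -> B -> C -> R) :
    \sum_(u : T) F u.1 u.2.1 u.2.2 = \sum_a \sum_b \sum_c F a b c.
  rewrite -(pair_bigA _ (fun a (v : B * C) => F a v.1 v.2))/=.
  by apply: eq_bigr => a _; rewrite -(pair_bigA _ (fun b c => F a b c)).
have J0 u : 0 <= J u by rewrite !mulr_ge0.
have Jgt0 u : 0 < J u -> [/\ 0 < P u.1, 0 < W u.1 u.2.1 & 0 < V u.2.1 u.2.2].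
  move=> h; split; rewrite lt_neqAle ?P0 ?V0 ?W0 andbT eq_sym.
  - by apply: contraTneq h; rewrite /J => ->; rewrite !mul0r ltxx.
  - by apply: contraTneq h; rewrite /J => ->; rewrite mulr0 mul0r ltxx.
  - by apply: contraTneq h; rewrite /J => ->; rewrite mulr0 ltxx.
have pos u : 0 < J u ->
    [/\ 0 < U u.1 u.2.2, 0 < PB u.2.1 & 0 < PC u.2.2].
  move=> /Jgt0[Pa Wab Vbc].
  have PBu : 0 < PB u.2.1 by exact: (output_gt0 (a := u.1)).
  split=> //; first exact: (output_gt0 (a := u.2.1)).
  exact: (output_gt0 (a := u.2.1)).
have sumJ : \sum_u J u = \sum_a P a.
  rewrite (sumT (fun a b c => P a * W a b * V b c)); apply: eq_bigr => a _.
  under eq_bigr do rewrite -mulr_sumr V1 mulr1.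
  by rewrite -mulr_sumr W1 mulr1.
have := @jensen_log2 T J r Q J0.
have -> : \sum_u J u * log2 (r u) =
    \sum_u J u * (log2 (U u.1 u.2.2) + log2 (PB u.2.1) -
                  (log2 (W u.1 u.2.1) + log2 (PC u.2.2))).
  apply: eq_bigr => u _; have := J0 u.
  rewrite le_eqVlt => /orP[/eqP <-|Ju]; first by rewrite !mul0r.
  have [Pa Wab Vbc] := Jgt0 _ Ju; have [Uu PBu PCu] := pos _ Ju.
  by rewrite /r log2_div ?mulr_gt0// !log2M.
have -> : \sum_u J u * (log2 (U u.1 u.2.2) + log2 (PB u.2.1) -
                  (log2 (W u.1 u.2.1) + log2 (PC u.2.2))) =
   \sum_a P a * neg_entropy (U a) + neg_entropy PB -
     (\sum_a P a * neg_entropy (W a) + neg_entropy PC).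
  under eq_bigr do rewrite mulrBr !mulrDr.
  rewrite sumrB !big_split/=; congr (_ + _ - (_ + _)).
  - rewrite (sumT (fun a b c => P a * W a b * V b c * log2 (U a c))).
    apply: eq_bigr => a _; rewrite exchange_big/= mulr_sumr.
    apply: eq_bigr => c _; rewrite -mulr_suml mulrA; congr (_ * _).
    by rewrite mulr_sumr; apply: eq_bigr => b _; rewrite mulrA.
  - rewrite (sumT (fun a b c => P a * W a b * V b c * log2 (PB b))).
    rewrite exchange_big/=; apply: eq_bigr => b _.
    rewrite mulr_suml; apply: eq_bigr => a _.
    by rewrite -mulr_suml -mulr_sumr V1 mulr1.
  - rewrite (sumT (fun a b c => P a * W a b * V b c * log2 (W a b))).
    apply: eq_bigr => a _; rewrite mulr_sumr; apply: eq_bigr => b _.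
    by rewrite -mulr_suml -mulr_sumr V1 mulr1 mulrA.
  - rewrite (sumT (fun a b c => P a * W a b * V b c * log2 (PC c))).
    rewrite exchange_big/=; under eq_bigr do rewrite exchange_big/=.
    rewrite exchange_big/=; apply: eq_bigr => c _.
    rewrite mulr_suml; apply: eq_bigr => b _.
    by rewrite -mulr_suml -mulr_suml.
under [X in _ -> _ <= X]eq_bigr do rewrite mulrBr.
rewrite sumrB -/U => h; suff : \sum_a P a * neg_entropy (U a) + neg_entropy PB -
  (\sum_a P a * neg_entropy (W a) + neg_entropy PC) <= 0 by rewrite /U; lra.
apply: h => [u Ju|u|].
- have [Pa Wab Vbc] := Jgt0 _ Ju; have [Uu PBu PCu] := pos _ Ju.
  by rewrite divr_gt0 ?mulr_gt0.
- have := J0 u; rewrite le_eqVlt => /orP[/eqP <-|Ju].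
    by rewrite mul0r mulr_ge0 ?divr_ge0// mulr_ge0.
  have [Pa Wab Vbc] := Jgt0 _ Ju; have [Uu PBu PCu] := pos _ Ju.
  by rewrite le_eqVlt; apply/orP; left; apply/eqP; rewrite /J /r /Q; field; rewrite !gt_eqF.
- rewrite sumJ /Q (sumT (fun a b c => P a * U a c * (PB b * V b c / PC c))).
  rewrite exchange_big/=; under eq_bigr do rewrite exchange_big/=.
  rewrite exchange_big/=.
  have -> : \sum_a P a = \sum_c PC c by rewrite /PC /PB !sum_output.
  apply: ler_sum => c _.
  under eq_bigr do rewrite -mulr_suml.
  rewrite -mulr_sumr -mulr_suml -/(output PB V c) -/PC.
  rewrite -/(output P U c) -output_comp -/PB -/PC.
  have [->|PCc] := eqVneq (PC c) 0; first by rewrite !mul0r.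
  by rewrite divff// mulr1.
Qed.

End Information.

(** * Product distributions: moments and entropy *)

Section ProductDistribution.
Variables (R : realType) (T A : finType) (Q : T -> A -> R).
Hypothesis Q1 : forall t, \sum_b Q t b = 1.

(** The law [Q t] may vary with the coordinate, so that noise under varying crossover probabilities,
    independent states and the random codebook are all instances. *)
Definition prod_dist (a : {ffun T -> A}) : R := \prod_t Q t (a t).

Lemma prod_dist_ge0 a : (forall t b, 0 <= Q t b) -> 0 <= prod_dist a.
Proof. by move=> Q0; apply: prodr_ge0. Qed.

Lemma sum_prod_dist : \sum_a prod_dist a = 1.
Proof. by rewrite -bigA_distr_bigA/= big1. Qed.

Lemma prod_dist_expect1 i (g : A -> R) :
  \sum_a prod_dist a * g (a i) = \sum_b Q i b * g b.
Proof.
transitivity (\sum_(a : {ffun T -> A})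
    \prod_t (Q t (a t) * (if t == i then g (a t) else 1))).
  apply: eq_bigr => a _; rewrite big_split/=; congr (_ * _).
  by rewrite -big_mkcond/= big_pred1_eq.
rewrite -(bigA_distr_bigA (fun t b => Q t b * (if t == i then g b else 1)))/=.
rewrite (bigD1 i)//= eqxx [X in _ * X]big1 ?mulr1// => t /negbTE ti.
by under eq_bigr do rewrite ti mulr1.
Qed.

Lemma prod_dist_expect2 i j (g h : A -> R) : i != j ->
  \sum_a prod_dist a * (g (a i) * h (a j)) =
  (\sum_b Q i b * g b) * (\sum_b Q j b * h b).
Proof.
move=> ij; transitivity (\sum_(a : {ffun T -> A}) \prod_t
    (Q t (a t) * ((if t == i then g (a t) else 1) *
                  (if t == j then h (a t) else 1)))).
  apply: eq_bigr => a _; rewrite big_split/=; congr (_ * _).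
  by rewrite big_split/= -!big_mkcond/= !big_pred1_eq.
rewrite -(bigA_distr_bigA (fun t b => Q t b *
  ((if t == i then g b else 1) * (if t == j then h b else 1))))/=.
rewrite (bigD1 i)//= (bigD1 j)//=; last by rewrite eq_sym.
rewrite eqxx (negbTE ij) eq_sym (negbTE ij) eqxx.
rewrite [X in _ * (_ * X)]big1 => [|t /andP[/negbTE ti /negbTE tj]]; last first.
  by under eq_bigr do rewrite ti tj !mulr1.
by rewrite mulr1; congr (_ * _); apply: eq_bigr => b _; rewrite ?mulr1 ?mul1r.
Qed.

Lemma prod_dist_expect_sum (g : T -> A -> R) :
  \sum_a prod_dist a * (\sum_t g t (a t)) = \sum_t \sum_b Q t b * g t b.
Proof.
under eq_bigr do rewrite mulr_sumr.
by rewrite exchange_big/=; apply: eq_bigr => t _; exact: prod_dist_expect1.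
Qed.

(** Cross terms factor, by independence, into products of means, which are zero. *)
Lemma prod_dist_variance (g : T -> A -> R) :
  (forall t, \sum_b Q t b * g t b = 0) ->
  \sum_a prod_dist a * (\sum_t g t (a t)) ^+ 2 = \sum_t \sum_b Q t b * g t b ^+ 2.
Proof.
move=> g0; transitivity (\sum_(a : {ffun T -> A}) \sum_i \sum_j
    prod_dist a * (g i (a i) * g j (a j))).
  apply: eq_bigr => a _; rewrite expr2 mulr_suml mulr_sumr.
  by apply: eq_bigr => i _; rewrite mulr_sumr mulr_sumr.
rewrite exchange_big/=; apply: eq_bigr => i _.
rewrite exchange_big/= (bigD1 i)//= [X in _ + X]big1 ?addr0 => [|j ji].
  by rewrite -(prod_dist_expect1 i (fun b => g i b ^+ 2)).
by rewrite prod_dist_expect2 1?eq_sym// g0 mul0r.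
Qed.

Lemma neg_entropy_prod_dist : (forall t b, 0 <= Q t b) ->
  neg_entropy prod_dist = \sum_t neg_entropy (Q t).
Proof.
move=> Q0; rewrite -prod_dist_expect_sum; apply: eq_bigr => a _.
have [->|] := eqVneq (prod_dist a) 0; first by rewrite !mul0r.
move=> /prodf_neq0 h; rewrite /prod_dist log2_prod// => t.
by rewrite lt_neqAle Q0 eq_sym h.
Qed.

End ProductDistribution.

(** * The binary symmetric channel and its entropy *)

Section BinarySymmetricChannel.
Variable R : realType.
Implicit Types (p v : R) (x y z : bool).

Lemma bsc_ge0 p x y : 0 <= p <= 1 -> 0 <= bsc p x y.
Proof. by move=> /andP[p0 p1]; rewrite /bsc; case: ifP => // _; rewrite subr_ge0. Qed.

Lemma sum_bsc p x : \sum_y bsc p x y = 1.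
Proof. by rewrite big_bool /bsc; case: x => /=; lra. Qed.

Lemma sum_bscl p y : \sum_x bsc p x y = 1.
Proof. by rewrite big_bool /bsc; case: y => /=; lra. Qed.

Lemma neg_entropy_bsc p x : neg_entropy (bsc p x) = - H2 p.
Proof.
rewrite /neg_entropy big_bool /bsc /H2 !xlog2xE; case: x => /=; lra.
Qed.

Lemma sum_bsc_log2 p x : \sum_y bsc p x y * (- log2 (bsc p x y)) = H2 p.
Proof.
under eq_bigr do rewrite mulrN.
by rewrite sumrN -/(neg_entropy (bsc p x)) neg_entropy_bsc opprK.
Qed.

Lemma bsc_comp p v x z :
  \sum_y bsc p x y * bsc v y z = bsc (p * (1 - v) + (1 - p) * v) x z.
Proof. by rewrite big_bool /bsc; case: x; case: z => /=; lra. Qed.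

(* The crossover probability turning BSC(p) into BSC(p'); at p = 1/2 the
   junk value 0/0 = 0 is the right one, since then p' = 1/2 as well. *)
Definition degrade (p p' : R) : R := (p' - p) / (1 - 2 * p).

Lemma degradeP (p p' : R) : p <= p' -> p' <= 2^-1 -> 0 <= p ->
  0 <= degrade p p' <= 1 /\
  p * (1 - degrade p p') + (1 - p) * degrade p p' = p'.
Proof.
rewrite /degrade => pp' p'2 p0; have [p2|p2] := eqVneq (1 - 2 * p) 0.
  by rewrite p2 invr0 mulr0; split; lra.
have {}p2 : 0 < 1 - 2 * p by rewrite lt_neqAle eq_sym p2/=; lra.
split; last by field; rewrite gt_eqF.
by rewrite divr_ge0 ?(ltW p2)//=; [rewrite ler_pdivrMr//; lra|lra].
Qed.

Lemma stochastic_bsc p : 0 <= p <= 1 -> stochastic (bsc p).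
Proof. by move=> p01; split=> *; [exact: bsc_ge0|exact: sum_bsc]. Qed.

(** BSC(p') is BSC(p) followed by another binary symmetric noise, which is doubly stochastic and
    cannot lower the entropy. *)
Lemma H2_homo (p p' : R) : 0 <= p -> p <= p' -> p' <= 2^-1 -> H2 p <= H2 p'.
Proof.
move=> p0 pp' p'2; have [v01 pv] := degradeP pp' p'2 p0.
have p01 : 0 <= p <= 1 by lra.
have := @neg_entropy_doubly_stochastic R _ (bsc p true) (bsc (degrade p p'))
  (fun b => bsc_ge0 _ _ p01) (stochastic_bsc v01) (sum_bscl _).
rewrite neg_entropy_bsc => h; rewrite -lerN2; apply: le_trans h.
rewrite -(neg_entropy_bsc p' true) le_eqVlt; apply/orP; left; apply/eqP.
by apply: eq_bigr => z _; rewrite /output bsc_comp pv.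
Qed.

Lemma H2_0 : H2 0 = 0 :> R.
Proof. by rewrite /H2 !xlog2xE subr0 log2_1; lra. Qed.

Lemma H2_half : H2 2^-1 = 1 :> R.
Proof.
have h : 1 - 2^-1 = 2^-1 :> R by lra.
by rewrite /H2 !xlog2xE h log2V// log2_2; lra.
Qed.

Lemma H2_ge0 p : 0 <= p <= 2^-1 -> 0 <= H2 p.
Proof. by move=> /andP[p0 p2]; rewrite -H2_0 H2_homo. Qed.

Lemma H2_le1 p : 0 <= p <= 2^-1 -> H2 p <= 1.
Proof. by move=> /andP[p0 p2]; rewrite -H2_half H2_homo. Qed.

End BinarySymmetricChannel.

(** * The block-fading channel for a fixed realization of the states *)

Section BlockChannel.
Variables (R : realType) (N B : nat).
Implicit Types (pi : bool * bool -> R) (s : states B) (x y z : word N B).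

(** The crossover [pi] takes the pair of states because the degrading noise depends on both
    components; the main and eavesdropper channels are the cases that read only one. *)
Definition blockW pi s x y : R :=
  \prod_(t : 'I_B * 'I_N) bsc (pi (s t.1)) (x t) (y t).

Lemma blockW_ge0 pi s x y : (forall c, 0 <= pi c <= 1) -> 0 <= blockW pi s x y.
Proof. by move=> pi01; apply: prodr_ge0 => t _; exact: bsc_ge0. Qed.

Lemma sum_blockW pi s x : \sum_y blockW pi s x y = 1.
Proof.
rewrite (@sum_prod_dist _ _ _ (fun t => bsc (pi (s t.1)) (x t)))// => t.
exact: sum_bsc.
Qed.

Lemma stochastic_blockW pi s :
  (forall c, 0 <= pi c <= 1) -> stochastic (blockW pi s).
Proof. by move=> pi01; split=> *; [exact: blockW_ge0|exact: sum_blockW]. Qed.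

Lemma sum_blockWl pi s y : \sum_x blockW pi s x y = 1.
Proof.
rewrite -(bigA_distr_bigA (fun (t : 'I_B * 'I_N) b => bsc (pi (s t.1)) b (y t))).
by rewrite big1// => t _; exact: sum_bscl.
Qed.

Lemma sum_blocks (f : 'I_B -> R) :
  \sum_(t : 'I_B * 'I_N) f t.1 = N%:R * \sum_k f k.
Proof.
rewrite -(pair_bigA _ (fun k (i : 'I_N) => f k))/= mulr_sumr.
by apply: eq_bigr => k _; rewrite sumr_const card_ord mulr_natl.
Qed.

Lemma neg_entropy_blockW pi s x : (forall c, 0 <= pi c <= 1) ->
  neg_entropy (blockW pi s x) = - (N%:R * \sum_k H2 (pi (s k))).
Proof.
move=> pi01; rewrite (@neg_entropy_prod_dist _ _ _ (fun t => bsc (pi (s t.1)) (x t))).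
- rewrite -sum_blocks -sumrN; apply: eq_bigr => t _; exact: neg_entropy_bsc.
- by move=> t; exact: sum_bsc.
- by move=> t b; exact: bsc_ge0.
Qed.

Lemma blockW_comp pi1 pi2 s x z :
  (forall c, 0 <= pi1 c) -> (forall c, pi1 c <= pi2 c) ->
  (forall c, pi2 c <= 2^-1) ->
  output (blockW pi1 s x) (blockW (fun c => degrade (pi1 c) (pi2 c)) s) z =
  blockW pi2 s x z.
Proof.
move=> p0 p12 p2; rewrite /output /blockW; under eq_bigr do rewrite -big_split/=.
rewrite -(bigA_distr_bigA (fun (t : 'I_B * 'I_N) b => bsc (pi1 (s t.1)) (x t) b *
  bsc (degrade (pi1 (s t.1)) (pi2 (s t.1))) b (z t))).
apply: eq_bigr => t _; rewrite bsc_comp.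
by have [_ ->] := degradeP (p12 (s t.1)) (p2 _) (p0 _).
Qed.

Definition blockP (Q : bool * bool -> R) s : R := \prod_k Q (s k).

Lemma blockP_ge0 Q s : (forall c, 0 <= Q c) -> 0 <= blockP Q s.
Proof. by move=> Q0; apply: prodr_ge0. Qed.

Lemma sum_blockP Q : \sum_c Q c = 1 -> \sum_s blockP Q s = 1.
Proof. by move=> Q1; exact: (@sum_prod_dist _ _ _ (fun=> Q)). Qed.

Lemma blockP_expect_sum Q (f : bool * bool -> R) : \sum_c Q c = 1 ->
  \sum_s blockP Q s * (\sum_k f (s k)) = B%:R * \sum_c Q c * f c.
Proof.
move=> Q1; rewrite (@prod_dist_expect_sum _ _ _ (fun=> Q) (fun=> Q1) (fun=> f)).
by rewrite sumr_const card_ord mulr_natl.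
Qed.

End BlockChannel.

(** * Random codebooks and threshold decoding *)

Section RandomCoding.
Variables (R : realType) (X : finType) (W : X -> X -> R) (tau : R).
Hypotheses (tau0 : 0 < tau) (W0 : forall x y, 0 <= W x y).
Hypothesis W1l : forall y, \sum_x W x y = 1.

Definition atypical (x : X) : R := \sum_y W x y * (W x y < tau)%R%:R.

Definition decode (J : finType) (j0 : J) (g : J -> X) (y : X) : J :=
  odflt j0 [pick j | tau <= W (g j) y].

Definition union_bound (J : finType) (g : J -> X) (j : J) : R :=
  atypical (g j) +
  \sum_(j' | j' != j) \sum_y W (g j) y * (tau <= W (g j') y)%R%:R.

(** If decoding fails although the sent codeword passes the threshold, then [pick] returned another
    index that passes it, and this index contributes to the sum. *)
Lemma decode_error (J : finType) (j0 : J) (g : J -> X) (j : J) :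
  \sum_y W (g j) y * (decode j0 g y != j)%:R <= union_bound g j.
Proof.
rewrite /union_bound exchange_big/= -big_split/=; apply: ler_sum => y _.
rewrite -mulr_sumr -mulrDr ler_wpM2l//.
have s0 : 0 <= \sum_(j' | j' != j) (tau <= W (g j') y)%R%:R :> R by rewrite sumr_ge0.
case: (eqVneq (decode j0 g y) j) => [_|]; first by rewrite addr_ge0.
case: (ltP (W (g j) y) tau) => [_ _|]; first by rewrite lerDl.
rewrite add0r /decode; case: pickP => /= [k tk _ kj|/(_ j) -> //].
by rewrite (bigD1 k)//= tk lerDl sumr_ge0.
Qed.

Let u : R := #|X|%:R^-1.

Definition codebookP (I : finType) (f : {ffun I -> X}) : R :=
  prod_dist (fun _ _ => u) f.

Lemma codebookP_ge0 (I : finType) (f : {ffun I -> X}) : 0 <= codebookP f.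
Proof. by apply: prod_dist_ge0 => _ _; rewrite invr_ge0. Qed.

Hypothesis X0 : (0 < #|X|)%N.

Lemma sum_uniform_card : \sum_(x : X) u = 1.
Proof. by rewrite sumr_const -[LHS]mulr_natl divff// pnatr_eq0 -lt0n. Qed.

Lemma sum_codebookP (I : finType) : \sum_(f : {ffun I -> X}) codebookP f = 1.
Proof. by apply: sum_prod_dist => _; exact: sum_uniform_card. Qed.

(** The codewords [f i] and [f j] are independent and uniform. Averaging over [f i] makes the
    received word uniform, and for each received word the likelihoods sum to one, so at most a
    fraction [u / tau] of the candidates for [f j] reaches [tau]. *)
Lemma expect_confusion (I : finType) (i j : I) : i != j ->
  \sum_(f : {ffun I -> X}) codebookP f *
     (\sum_y W (f i) y * (tau <= W (f j) y)%R%:R) <= u / tau.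
Proof.
move=> ij; under eq_bigr do rewrite mulr_sumr.
rewrite exchange_big/=.
apply: (@le_trans _ _ (\sum_(y : X) u * (u / tau))).
  apply: ler_sum => y _.
  rewrite (prod_dist_expect2 (Q := fun _ _ => u) (fun _ => sum_uniform_card)
    (fun x => W x y) (fun x => (tau <= W x y)%R%:R))//.
  rewrite -!mulr_sumr W1l mulr1 !ler_wpM2l ?invr_ge0//.
  rewrite -div1r ler_pdivlMr// mulr_suml -[leRHS](W1l y); apply: ler_sum => x _.
  by case: (leP tau (W x y)) => tW; rewrite ?mul1r ?mul0r.
by rewrite -mulr_suml sum_uniform_card mul1r.
Qed.

(** The injection [e] selects a part of the codebook: the receiver searches all of it, the
    eavesdropper only the codewords of a known message. *)
Lemma expect_union_bound (I J : finType) (e : J -> I) (j : J) : injective e ->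
  \sum_(f : {ffun I -> X}) codebookP f * union_bound (fun j => f (e j)) j <=
  \sum_(x : X) u * atypical x + #|J|.-1%:R * (u / tau).
Proof.
move=> einj; under eq_bigr do rewrite mulrDr [X in _ + X]mulr_sumr.
rewrite big_split/= /codebookP (prod_dist_expect1 (Q := fun _ _ => u)
  (fun _ => sum_uniform_card) (e j) atypical) lerD2l.
rewrite exchange_big/=; have <- : \sum_(j' | j' != j) (u / tau) = #|J|.-1%:R * (u / tau).
  rewrite sumr_const -[LHS]mulr_natl; congr (_%:R * _).
  by rewrite -(cardC1 j); apply: eq_card => k; rewrite !inE.
apply: ler_sum => k kj; apply: expect_confusion.
by rewrite (inj_eq einj) eq_sym.
Qed.

End RandomCoding.

Lemma exists_le_expect (R : realType) (A : finType) (P F : A -> R) (c : R) :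
  (forall a, 0 <= P a) -> \sum_a P a = 1 -> \sum_a P a * F a <= c ->
  exists a, F a <= c.
Proof.
move=> P0 P1 Pc; apply: contrapT => /forallNP h.
have Fc a : c < F a by rewrite ltNge; apply/negP; exact: h.
have := Pc; apply/negP; rewrite -ltNge.
have [a Pa] : exists a, 0 < P a.
  apply: contrapT => /forallNP g; suff : \sum_a P a <= 0 by rewrite P1 ler10.
  by apply: sumr_le0 => a _; rewrite leNgt; apply/negP; exact: g.
rewrite -[c]mul1r -P1 mulr_suml (bigD1 a)//= [ltRHS](bigD1 a)//=.
rewrite ltr_leD ?ltr_pM2l//; apply: ler_sum => b _.
by rewrite ler_wpM2l// ltW.
Qed.

Lemma neg_entropy_ge_uniform (R : realType) (A : finType) (P : A -> R) :
  (forall a, 0 <= P a) -> \sum_a P a = 1 -> - log2 #|A|%:R <= neg_entropy P.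
Proof.
move=> P0 P1.
have A0 : (0 < #|A|)%N.
  rewrite lt0n; apply: contraPneq P1 => A0; rewrite big1 => [|a _].
    by apply/eqP; rewrite eq_sym oner_eq0.
  by have := card0_eq A0 a; rewrite inE.
have u0 : 0 < #|A|%:R^-1 :> R by rewrite invr_gt0 ltr0n.
have := @jensen_log2 R A P (fun a => #|A|%:R^-1 / P a) (fun=> #|A|%:R^-1) P0.
have -> : \sum_a P a * log2 (#|A|%:R^-1 / P a) = - log2 #|A|%:R - neg_entropy P.
  have <- : (\sum_a P a) * - log2 #|A|%:R = - log2 #|A|%:R by rewrite P1 mul1r.
  rewrite mulr_suml -sumrB; apply: eq_bigr => a _.
  have := P0 a; rewrite le_eqVlt => /orP[/eqP <-|Pa]; first by rewrite !mul0r subr0.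
  by rewrite log2_div// log2V ?ltr0n// mulrBr.
rewrite subr_le0; apply => [a Pa|a|]; first by rewrite divr_gt0.
- have := P0 a; rewrite le_eqVlt => /orP[/eqP <-|Pa]; first by rewrite mul0r ltW.
  by rewrite mulrC divfK// gt_eqF.
- by rewrite P1 sum_uniform_card.
Qed.

(** * Law of large numbers for the log-likelihood over blocks *)

Section BlockLLN.
Variables (R : realType) (pi : bool * bool -> R) (Q : bool * bool -> R).
Hypotheses (pi01 : forall c, 0 <= pi c <= 1).
Hypotheses (Q0 : forall c, 0 <= Q c) (Q1 : \sum_c Q c = 1).

Let h : R := \sum_c Q c * H2 (pi c).

Let symbol_var (c : bool * bool) (x : bool) : R :=
  \sum_y bsc (pi c) x y * (- log2 (bsc (pi c) x y) - H2 (pi c)) ^+ 2.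

(** A crude constant: summing the symbol variances over all state pairs and inputs, instead of
    averaging them, makes it uniform in the codeword and the states. *)
Definition info_var : R :=
  \sum_c \sum_x symbol_var c x + \sum_c Q c * (H2 (pi c) - h) ^+ 2.

Let symbol_var_ge0 c x : 0 <= symbol_var c x.
Proof. by apply: sumr_ge0 => y _; rewrite mulr_ge0 ?sqr_ge0// bsc_ge0. Qed.

Let state_var_ge0 : 0 <= \sum_c Q c * (H2 (pi c) - h) ^+ 2.
Proof. by apply: sumr_ge0 => c _; rewrite mulr_ge0// sqr_ge0. Qed.

Lemma info_var_ge0 : 0 <= info_var.
Proof. by rewrite addr_ge0// sumr_ge0// => c _; exact: sumr_ge0. Qed.

(* Chebyshev's inequality, once for the noise given the states and once for the
   states. N plays no role in the bound, so letting B grow is enough. *)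
Lemma block_lln (N B : nat) (x : word N B) (delta : R) :
  (0 < N)%N -> (0 < B)%N -> 0 < delta ->
  \sum_s blockP Q s *
    atypical (blockW pi s) (2 `^ (- ((N * B)%:R * (h + delta)))) x
  <= 2 * info_var / (B%:R * delta ^+ 2).
Proof.
move=> N0 B0 d0; set n : R := (N * B)%:R; set tau := 2 `^ _.
have n0 : 0 < n by rewrite ltr0n muln_gt0 N0.
have nE : n = N%:R * B%:R by rewrite /n natrM.
pose G (s : states B) (t : 'I_B * 'I_N) (y : bool) : R :=
  - log2 (bsc (pi (s t.1)) (x t) y) - H2 (pi (s t.1)).
pose D (s : states B) : R := N%:R * \sum_k (H2 (pi (s k)) - h).
pose V : R := \sum_c \sum_b symbol_var c b.
have Vge c b : symbol_var c b <= V.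
  rewrite /V (bigD1 c)//= (bigD1 b)//= -addrA lerDl addr_ge0//.
    exact: sumr_ge0.
  by apply: sumr_ge0 => c' _; exact: sumr_ge0.
(* Below the threshold, the noise deviation plus the state deviation [D s] is at least [n * delta],
   and (a + b)^2 <= 2 a^2 + 2 b^2 separates the two. The factor [blockW] removes words of
   probability zero, where the logarithm is a default value. *)
have markov s y : blockW pi s x y * (blockW pi s x y < tau)%R%:R <=
    (2 * (blockW pi s x y * (\sum_t G s t (y t)) ^+ 2) +
     2 * (D s ^+ 2 * blockW pi s x y)) / (n * delta) ^+ 2.
  set w := blockW pi s x y.
  have : 0 <= w by exact: blockW_ge0.
  rewrite le_eqVlt => /orP[/eqP <-|w0]; first by rewrite !(mul0r,mulr0,addr0).
  have sq : 0 <= (n * delta) ^+ 2 by rewrite sqr_ge0.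
  case: (ltP w tau) => [wt|_] /=; last first.
    by rewrite mulr0 divr_ge0// addr_ge0// mulr_ge0// mulr_ge0 ?sqr_ge0// ltW.
  rewrite mulr1 ler_pdivlMr ?exprn_gt0 ?mulr_gt0//.
  have sumE : \sum_t G s t (y t) + D s = - log2 w - n * h.
    rewrite /w /blockW log2_prod => [|t]; last first.
      rewrite lt_neqAle bsc_ge0// andbT eq_sym.
      by have /prodf_neq0 := lt0r_neq0 w0; apply.
    have -> : D s = \sum_(t : 'I_B * 'I_N) (H2 (pi (s t.1)) - h).
      by rewrite (sum_blocks N (fun k => H2 (pi (s k)) - h)).
    rewrite -big_split/= -[X in X - n * h]sumrN.
    transitivity (\sum_(t : 'I_B * 'I_N) (- log2 (bsc (pi (s t.1)) (x t) (y t)) - h)).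
      by apply: eq_bigr => t _; rewrite /G addrA subrK.
    rewrite big_split/= sumr_const card_prod !card_ord -[X in _ + X]mulr_natl.
    by rewrite mulrN mulnC.
  have big : n * delta <= \sum_t G s t (y t) + D s.
    rewrite sumE; have : log2 w <= log2 tau by rewrite ler_log2// ltW.
    by rewrite /tau log2_powR mulrDr; lra.
  set a := \sum_t _ in sumE big *; set b := D s in sumE big *.
  have le1 : (n * delta) ^+ 2 <= (a + b) ^+ 2.
    have nd : 0 <= n * delta by rewrite mulr_ge0// ltW.
    by rewrite ler_sqr// nnegrE (le_trans nd).
  have le2 : (a + b) ^+ 2 <= 2 * a ^+ 2 + 2 * b ^+ 2.
    by rewrite -subr_ge0; have := sqr_ge0 (a - b); lra.
  apply: (@le_trans _ _ (w * (2 * a ^+ 2 + 2 * b ^+ 2))); last by lra.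
  by rewrite ler_pM2l// (le_trans le1).
have step s : atypical (blockW pi s) tau x <=
    (2 * (n * V) + 2 * D s ^+ 2) / (n * delta) ^+ 2.
  apply: (le_trans (ler_sum _ (fun y _ => markov s y))).
  rewrite -mulr_suml ler_wpM2r ?invr_ge0 ?sqr_ge0//.
  rewrite big_split/= -!mulr_sumr sum_blockW mulr1 lerD2r ler_wpM2l//.
  rewrite (@prod_dist_variance R _ _ (fun t => bsc (pi (s t.1)) (x t))).
  - have -> : n * V = \sum_(t : 'I_B * 'I_N) V.
      by rewrite sumr_const card_prod !card_ord -[RHS]mulr_natl mulnC.
    by apply: ler_sum => t _; exact: Vge.
  - by move=> t; exact: sum_bsc.
  - move=> t; rewrite /G; under eq_bigr do rewrite mulrBr.
    by rewrite sumrB -mulr_suml sum_bsc mul1r sum_bsc_log2 subrr.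
have stepE : \sum_s blockP Q s * atypical (blockW pi s) tau x <=
    \sum_s blockP Q s * ((2 * (n * V) + 2 * D s ^+ 2) / (n * delta) ^+ 2).
  by apply: ler_sum => s _; rewrite ler_wpM2l// blockP_ge0.
apply: (le_trans stepE).
have varD : \sum_s blockP Q s * D s ^+ 2 =
    N%:R ^+ 2 * (B%:R * \sum_c Q c * (H2 (pi c) - h) ^+ 2).
  under eq_bigr do rewrite /D exprMn mulrCA.
  rewrite -mulr_sumr (@prod_dist_variance R _ _ (fun=> Q) (fun=> Q1)
    (fun _ c => H2 (pi c) - h)); last first.
    by move=> _; under eq_bigr do rewrite mulrBr; rewrite sumrB -mulr_suml Q1 mul1r subrr.
  by rewrite sumr_const card_ord -[X in _ * X = _]mulr_natl.
under eq_bigr do rewrite mulrA mulrDr.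
rewrite -mulr_suml big_split/= -mulr_suml sum_blockP// mul1r.
under [X in _ + X]eq_bigr do rewrite mulrCA.
rewrite -mulr_sumr varD /info_var -/V.
set V2 := \sum_c _.
have N0R : 0 < N%:R :> R by rewrite ltr0n.
have B0R : 0 < B%:R :> R by rewrite ltr0n.
(* The noise variance is enlarged by a factor [N] to match the order [N ^ 2 * B] of the state
   variance. *)
have -> : 2 * (V + V2) / (B%:R * delta ^+ 2) =
  (2 * (n * (N%:R * V)) + 2 * (N%:R ^+ 2 * (B%:R * V2))) / (n * delta) ^+ 2.
  by rewrite nE; field; rewrite !gt_eqF.
rewrite ler_wpM2r ?invr_ge0 ?sqr_ge0// lerD2r !ler_pM2l//.
rewrite ler_peMl ?ler1n//.
by apply: sumr_ge0 => c _; exact: sumr_ge0.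
Qed.

End BlockLLN.

(** * Uniform messages: Fano's inequality and the degraded-channel bound *)

Section UniformMessage.
Variables (R : realType) (M : nat).
Hypothesis M0 : (0 < M)%N.

Let M0R : 0 < M%:R :> R. Proof. by rewrite ltr0n. Qed.

Definition mixture (Y : finType) (P : 'I_M -> Y -> R) (y : Y) : R :=
  \sum_m M%:R^-1 * P m y.

(** This is H(Y) - H(Y|M). It serves for the message and, with another size, for the random index
    inside one message. *)
Definition mutual_info (Y : finType) (P : 'I_M -> Y -> R) : R :=
  M%:R^-1 * (\sum_m neg_entropy (P m)) - neg_entropy (mixture P).

Lemma sum_uniform (c : R) : \sum_(m < M) M%:R^-1 * c = c.
Proof. by rewrite sumr_const card_ord -[LHS]mulr_natl mulrA divff ?mul1r// gt_eqF. Qed.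

(* The posterior guess puts mass 1/2 on the decoded message and spreads the
   rest uniformly; comparing it with the true posterior yields Fano's bound. *)
Lemma fano (Y : finType) (P : 'I_M -> Y -> R) (d : Y -> 'I_M) :
  stochastic P ->
  log2 M%:R - 1 -
    (\sum_m M%:R^-1 * \sum_y P m y * (d y != m)%:R) * log2 M%:R
  <= mutual_info P.
Proof.
move=> [P0 P1].
pose PY := mixture P.
pose q (m : 'I_M) y : R := 2^-1 * (d y == m)%:R + 2^-1 * M%:R^-1.
pose J (u : 'I_M * Y) : R := M%:R^-1 * P u.1 u.2.
pose r (u : 'I_M * Y) : R := PY u.2 * q u.1 u.2 / J u.
pose Q (u : 'I_M * Y) : R := PY u.2 * q u.1 u.2.
have Mi : 0 < M%:R^-1 :> R by rewrite invr_gt0.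
have q0 m y : 0 < q m y.
  by rewrite ltr_wpDl// ?mulr_ge0// mulr_gt0// invr_gt0 ltr0n.
have q1 y : \sum_m q m y = 1.
  rewrite big_split/= -!mulr_sumr (bigD1 (d y))//= eqxx big1 => [|m]; last first.
    by rewrite eq_sym => /negbTE ->.
  by under eq_bigr do rewrite -[M%:R^-1]mulr1; rewrite sum_uniform /= addr0; lra.
have J0 u : 0 <= J u by rewrite mulr_ge0// ltW.
have PY0 y : 0 <= PY y by apply: sumr_ge0 => m _; rewrite mulr_ge0// ltW.
have JY u : J u <= PY u.2.
  rewrite /PY /mixture (bigD1 u.1)//= lerDl; apply: sumr_ge0 => m _.
  by rewrite mulr_ge0// ltW.
have sumPair (F : 'I_M -> Y -> R) : \sum_u F u.1 u.2 = \sum_m \sum_y F m y.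
  by rewrite -(pair_bigA _ F).
have := @jensen_log2 R _ J r Q J0.
have -> : \sum_u J u * log2 (r u) = \sum_(u : 'I_M * Y)
   (J u * log2 (PY u.2) + J u * log2 (q u.1 u.2)
      + J u * log2 M%:R - J u * log2 (P u.1 u.2)).
  apply: eq_bigr => u _; have := J0 u.
  rewrite le_eqVlt => /orP[/eqP <-|Ju]; first by rewrite !mul0r; lra.
  have PYu : 0 < PY u.2 by rewrite (lt_le_trans Ju).
  have Pu : 0 < P u.1 u.2 by move: Ju; rewrite /J pmulr_rgt0.
  rewrite /r log2_div ?mulr_gt0// log2M// {2}/J log2M// log2V//; ring.
have -> : \sum_(u : 'I_M * Y) (J u * log2 (PY u.2) + J u * log2 (q u.1 u.2)
      + J u * log2 M%:R - J u * log2 (P u.1 u.2)) =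
   neg_entropy PY + \sum_(u : 'I_M * Y) J u * log2 (q u.1 u.2) + log2 M%:R
   - M%:R^-1 * \sum_m neg_entropy (P m).
  rewrite sumrB !big_split/=; congr (_ + _ + _ - _).
  - rewrite (sumPair (fun m y => M%:R^-1 * P m y * log2 (PY y))) exchange_big/=.
    by apply: eq_bigr => y _; rewrite -mulr_suml.
  - rewrite -mulr_suml (sumPair (fun m y => M%:R^-1 * P m y)).
    under eq_bigr do rewrite -mulr_sumr P1.
    by rewrite sum_uniform mul1r.
  - rewrite (sumPair (fun m y => M%:R^-1 * P m y * log2 (P m y))) mulr_sumr.
    apply: eq_bigr => m _; rewrite mulr_sumr; apply: eq_bigr => y _.
    by rewrite -mulrA.
have lq : - 1 - (\sum_m M%:R^-1 * \sum_y P m y * (d y != m)%:R) * log2 M%:R <=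
    \sum_(u : 'I_M * Y) J u * log2 (q u.1 u.2).
  rewrite (sumPair (fun m y => M%:R^-1 * P m y * log2 (q m y))).
  have -> : - 1 - (\sum_m M%:R^-1 * \sum_y P m y * (d y != m)%:R) * log2 M%:R =
     \sum_m \sum_y M%:R^-1 * P m y * (- 1 - (d y != m)%:R * log2 M%:R).
    rewrite -[X in X - _](sum_uniform (- 1)) mulr_suml -sumrB; apply: eq_bigr => m _.
    under [RHS]eq_bigr do rewrite -mulrA mulrBr mulrN1 mulrA.
    rewrite -mulr_sumr sumrB sumrN P1 -mulrA -mulr_suml.
    by rewrite mulrBr.
  apply: ler_sum => m _; apply: ler_sum => y _.
  apply: ler_wpM2l; first by rewrite mulr_ge0// ltW.
  have half : - 1 = log2 2^-1 :> R by rewrite log2V// log2_2.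
  case: (eqVneq (d y) m) => [dm|dm]; rewrite ?mul0r ?subr0 ?mul1r half.
    by rewrite ler_log2 ?invr_gt0// /q dm eqxx mulr1 lerDl mulr_ge0// ltW.
  rewrite -log2V// -log2M// ?invr_gt0// ler_log2// ?mulr_gt0 ?invr_gt0//.
  by rewrite /q (negbTE dm) mulr0 add0r.
rewrite /mutual_info -/PY => h.
suff : neg_entropy PY + \sum_(u : 'I_M * Y) J u * log2 (q u.1 u.2) + log2 M%:R
   - M%:R^-1 * (\sum_m neg_entropy (P m)) <= 0 by lra.
apply: h => [u Ju|u|].
- by rewrite divr_gt0// mulr_gt0// (lt_le_trans Ju).
- have := J0 u; rewrite le_eqVlt => /orP[/eqP <-|Ju].
    by rewrite mul0r mulr_ge0// ltW.
  by rewrite mulrC divfK// gt_eqF.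
- rewrite (sumPair (fun m y => PY y * q m y)) exchange_big/=.
  under eq_bigr do rewrite -mulr_sumr q1 mulr1.
  rewrite (sumPair (fun m y => M%:R^-1 * P m y)).
  by rewrite /PY /mixture exchange_big.
Qed.

(** Split I(M;Y) - I(M;Z) as [H(Y) - H(Z)] + [H(Z|M) - H(Y|M)]. The first bracket is at most 0 since
    [V] is doubly stochastic; the second is bounded message by message through data processing from
    the codeword, the noise entropies being the same for all codewords. *)
Lemma mutual_info_degraded (X : finType) (P : 'I_M -> X -> R)
    (W U V : X -> X -> R) (hW hU : R) :
  stochastic P -> stochastic W -> stochastic V ->
  (forall y, \sum_x V x y = 1) ->
  (forall x z, output (W x) V z = U x z) ->
  (forall x, neg_entropy (W x) = - hW) -> (forall x, neg_entropy (U x) = - hU) ->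
  mutual_info (fun m => output (P m) W) - mutual_info (fun m => output (P m) U)
  <= hU - hW.
Proof.
move=> [P0 P1] sW sV V1 WVU WH UH; rewrite /mutual_info.
have eU m z : output (P m) U z = output (output (P m) W) V z.
  by rewrite output_comp; apply: eq_bigr => x _; rewrite WVU.
set PY := mixture (fun m => output (P m) W).
have Mi : 0 <= M%:R^-1 :> R by rewrite invr_ge0.
have PY0 y : 0 <= PY y.
  apply: sumr_ge0 => m _; rewrite mulr_ge0// output_ge0//.
  by have [] := sW.
have nZ : neg_entropy (mixture (fun m => output (P m) U)) = neg_entropy (output PY V).
  apply: eq_bigr => z _; suff -> : mixture (fun m => output (P m) U) z =
    output PY V z by [].
  rewrite /output /PY /mixture; under [RHS]eq_bigr do rewrite mulr_suml.
  rewrite exchange_big/=; apply: eq_bigr => m _.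
  rewrite -/(output (P m) U z) eU mulr_sumr; apply: eq_bigr => y _.
  by rewrite mulrA.
have Zle := neg_entropy_doubly_stochastic PY0 sV V1.
have mle m : neg_entropy (output (P m) W) - neg_entropy (output (P m) U) <= hU - hW.
  have := neg_entropy_data_processing (P0 m) sW sV.
  have -> : neg_entropy (output (output (P m) W) V) = neg_entropy (output (P m) U).
    by apply: eq_bigr => z _; rewrite -eU.
  move=> /le_trans; apply.
  have UWV x : neg_entropy (output (W x) V) = - hU.
    by rewrite -(UH x); apply: eq_bigr => z _; rewrite WVU.
  under eq_bigr do rewrite WH UWV.
  by rewrite -mulr_suml P1; lra.
rewrite nZ.
have : M%:R^-1 * (\sum_m neg_entropy (output (P m) W)) -
       M%:R^-1 * (\sum_m neg_entropy (output (P m) U)) <= hU - hW.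
  rewrite -mulrBr -sumrB -[leRHS]sum_uniform mulr_sumr; apply: ler_sum => m _.
  by rewrite ler_wpM2l.
lra.
Qed.

End UniformMessage.

(** * Leakage and error probability of a code in terms of output laws *)

Section Codes.
Variables (R : realType) (p1 p2 ps1 ps2 q1 qs1 : R) (N B M : nat).
Hypothesis M0 : (0 < M)%N.
Variable c : Defs.code R N B M.
Hypothesis vc : valid_code c.

Definition cross_main (u : bool * bool) : R := pmain p1 p2 u.1.
Definition cross_eve (u : bool * bool) : R := peve ps1 ps2 u.2.
Definition Qstate (u : bool * bool) : R :=
  (if u.1 then q1 else 1 - q1) * (if u.2 then qs1 else 1 - qs1).

Lemma MI_givenE (s : states B) : 0 <= ps1 <= 1 -> 0 <= ps2 <= 1 ->
  MI_given ps1 ps2 c s =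
  mutual_info (fun m => output (enc c m) (blockW cross_eve s)).
Proof.
move=> ps1_01 ps2_01; set P := fun m => _.
have M0R : 0 < M%:R :> R by rewrite ltr0n.
have Mi : 0 < M%:R^-1 :> R by rewrite invr_gt0.
have c01 u : 0 <= cross_eve u <= 1 by rewrite /cross_eve /peve; case: ifP.
have P0 m z : 0 <= P m z.
  by apply: output_ge0 => *; [case: vc|exact: blockW_ge0].
have PZE z : PZ ps1 ps2 c s z = mixture P z by [].
have PMZE m z : PMZ ps1 ps2 c s m z = M%:R^-1 * P m z by [].
have PZge m z : M%:R^-1 * P m z <= mixture P z.
  rewrite /mixture (bigD1 m)//= lerDl; apply: sumr_ge0 => m' _.
  by rewrite mulr_ge0// ltW.
transitivity (\sum_m \sum_z M%:R^-1 * P m z * (log2 (P m z) - log2 (mixture P z))).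
  apply: eq_bigr => m _; apply: eq_bigr => z _.
  rewrite PMZE PZE; have [Pmz|Pmz] := eqVneq (M%:R^-1 * P m z) 0.
    by rewrite Pmz mul0r.
  have Pmz0 : 0 < M%:R^-1 * P m z by rewrite lt_neqAle eq_sym Pmz mulr_ge0// ltW.
  have Pz : 0 < P m z by move: Pmz0; rewrite pmulr_rgt0.
  rewrite -mulf_div divff ?gt_eqF// mul1r.
  by rewrite log2_div// (lt_le_trans Pmz0).
under eq_bigr do under eq_bigr do rewrite mulrBr.
under eq_bigr do rewrite sumrB.
rewrite sumrB /mutual_info; congr (_ - _).
  rewrite mulr_sumr; apply: eq_bigr => m _; rewrite mulr_sumr.
  by apply: eq_bigr => z _; rewrite -mulrA.
rewrite exchange_big/=; apply: eq_bigr => z _.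
by rewrite -mulr_suml.
Qed.

Lemma err_probE :
  err_prob p1 p2 q1 qs1 c = \sum_s blockP Qstate s *
    \sum_m M%:R^-1 * \sum_y output (enc c m) (blockW cross_main s) y *
                            (dec c y s != m)%:R.
Proof.
rewrite /err_prob exchange_big/=; apply: eq_bigr => s _.
rewrite mulr_sumr; apply: eq_bigr => m _.
rewrite exchange_big/= !mulr_sumr; apply: eq_bigr => y _.
rewrite mulr_suml !mulr_sumr; apply: eq_bigr => x _.
rewrite (_ : Pstate q1 qs1 s = blockP Qstate s)//.
rewrite (_ : Wmain p1 p2 s x y = blockW cross_main s x y)//.
by case: (dec c y s != m) => /=; ring.
Qed.

End Codes.

(** * The wiretap channel: averages over the states and the converse *)

Section WiretapChannel.
Variables (R : realType) (p1 p2 ps1 ps2 q1 qs1 : R).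
Hypotheses (q1_01 : 0 <= q1 <= 1) (qs1_01 : 0 <= qs1 <= 1).
Hypotheses (p1_ge0 : 0 <= p1) (p12 : p1 <= p2) (p2s1 : p2 <= ps1).
Hypotheses (ps12 : ps1 <= ps2) (ps2_half : ps2 <= 2^-1).

Let pi1 := cross_main p1 p2.
Let pi2 := cross_eve ps1 ps2.
Let Q := Qstate q1 qs1.

Lemma Qstate_ge0 u : 0 <= Q u.
Proof.
move/andP: q1_01 => [? ?]; move/andP: qs1_01 => [? ?].
by rewrite /Q /Qstate mulr_ge0//; case: ifP => _; rewrite ?subr_ge0.
Qed.

Lemma sum_Qstate : \sum_u Q u = 1.
Proof.
by rewrite -(pair_bigA _ (fun a b => Q (a, b)))/= !big_bool /= /Q /Qstate/=; ring.
Qed.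

Lemma Qstate_cross_main : \sum_u Q u * H2 (pi1 u) = q1 * H2 p1 + (1 - q1) * H2 p2.
Proof.
rewrite -(pair_bigA _ (fun a b => Q (a, b) * H2 (pi1 (a, b))))/= !big_bool /=.
by rewrite /Q /Qstate /pi1 /cross_main /pmain/=; ring.
Qed.

Lemma Qstate_cross_eve : \sum_u Q u * H2 (pi2 u) = qs1 * H2 ps1 + (1 - qs1) * H2 ps2.
Proof.
rewrite -(pair_bigA _ (fun a b => Q (a, b) * H2 (pi2 (a, b))))/= !big_bool /=.
by rewrite /Q /Qstate /pi2 /cross_eve /peve/=; ring.
Qed.

Lemma cross_main_bounds u : 0 <= pi1 u <= 2^-1.
Proof.
by move: p1_ge0 p12 p2s1 ps12 ps2_half => *; rewrite /pi1 /cross_main /pmain; case: ifP; lra.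
Qed.

Lemma cross_eve_bounds u : 0 <= pi2 u <= 2^-1.
Proof.
by move: p1_ge0 p12 p2s1 ps12 ps2_half => *; rewrite /pi2 /cross_eve /peve; case: ifP; lra.
Qed.

Lemma cross_main_le_eve u : pi1 u <= pi2 u.
Proof.
move: p1_ge0 p12 p2s1 ps12 ps2_half => *.
by rewrite /pi1 /pi2 /cross_eve /peve /cross_main /pmain; do 2 case: ifP; lra.
Qed.

Let C := qs1 * H2 ps1 + (1 - qs1) * H2 ps2 - q1 * H2 p1 - (1 - q1) * H2 p2.

(** Fano's inequality and the degraded-channel bound hold for each realization of the states;
    averaging comes last and turns the entropy gap of the blocks into [C]. The final 1 is the one in
    Fano's inequality. *)
Lemma code_converse (N B M : nat) (c : Defs.code R N B M) :
  (0 < M)%N -> valid_code c ->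
  log2 M%:R * (1 - err_prob p1 p2 q1 qs1 c) <=
  (N * B)%:R * C + leakage ps1 ps2 q1 qs1 c + 1.
Proof.
move=> M0 vc.
have pi1_01 u : 0 <= pi1 u <= 1 by have := cross_main_bounds u; lra.
have pi2_01 u : 0 <= pi2 u <= 1 by have := cross_eve_bounds u; lra.
pose V (s : states B) := @blockW R N B (fun c => degrade (pi1 c) (pi2 c)) s.
have deg u : 0 <= degrade (pi1 u) (pi2 u) <= 1.
  have := cross_main_bounds u; have := cross_eve_bounds u => h1 h2.
  by apply: (degradeP (cross_main_le_eve u) _ _).1; lra.
pose e s : R := \sum_m M%:R^-1 * \sum_y output (enc c m) (blockW pi1 s) y *
                            (dec c y s != m)%:R.
have step (s : states B) : log2 M%:R <=
   N%:R * (\sum_k (H2 (pi2 (s k)) - H2 (pi1 (s k)))) + MI_given ps1 ps2 c s + 1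
   + e s * log2 M%:R.
  have sP : stochastic (enc c) by [].
  have : mutual_info (fun m => output (enc c m) (blockW pi1 s)) -
         mutual_info (fun m => output (enc c m) (blockW pi2 s)) <=
         N%:R * (\sum_k H2 (pi2 (s k))) - N%:R * (\sum_k H2 (pi1 (s k))).
    apply: (@mutual_info_degraded R M M0 _ (enc c) _ _ (V s)) => //.
    - exact: stochastic_blockW.
    - exact: stochastic_blockW.
    - exact: sum_blockWl.
    - move=> x z; apply: blockW_comp => u; [|exact: cross_main_le_eve|].
        by have := cross_main_bounds u; lra.
      by have := cross_eve_bounds u; lra.
    - by move=> x; rewrite neg_entropy_blockW.
    - by move=> x; rewrite neg_entropy_blockW.
  have := @fano R M M0 _ (fun m => output (enc c m) (blockW pi1 s))
    (fun y => dec c y s) (stochastic_output sP (stochastic_blockW N s pi1_01)).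
  rewrite MI_givenE//; [|by move: p1_ge0 p12 p2s1 ps12 ps2_half => *; lra..].
  rewrite -/(e s) -/pi2.
  have -> : \sum_k (H2 (pi2 (s k)) - H2 (pi1 (s k))) =
    \sum_k H2 (pi2 (s k)) - \sum_k H2 (pi1 (s k)) by exact: sumrB.
  by rewrite mulrBr; lra.
have Q1 := sum_Qstate.
have : \sum_(s : states B) blockP Q s * log2 M%:R <= \sum_(s : states B) blockP Q s *
   (N%:R * (\sum_k (H2 (pi2 (s k)) - H2 (pi1 (s k)))) + MI_given ps1 ps2 c s + 1
   + e s * log2 M%:R).
  apply: ler_sum => s _; apply: ler_wpM2l; last exact: step.
  by apply: blockP_ge0; exact: Qstate_ge0.
rewrite -mulr_suml sum_blockP// mul1r.
under [X in _ <= X -> _]eq_bigr do rewrite !mulrDr mulr1 mulrCA.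
rewrite !big_split/= -mulr_sumr sum_blockP//.
rewrite (@blockP_expect_sum R B Q (fun u => H2 (pi2 u) - H2 (pi1 u)))//.
have -> : \sum_u Q u * (H2 (pi2 u) - H2 (pi1 u)) =
    \sum_u Q u * H2 (pi2 u) - \sum_u Q u * H2 (pi1 u).
  by rewrite -sumrB; apply: eq_bigr => u _; rewrite -mulrBr.
rewrite Qstate_cross_main Qstate_cross_eve.
under [X in _ <= _ + X -> _]eq_bigr do rewrite mulrA.
rewrite -mulr_suml -err_probE natrM.
rewrite -/(leakage ps1 ps2 q1 qs1 c) /C.
lra.
Qed.

Lemma achievable_le (r : R) : achievable p1 p2 ps1 ps2 q1 qs1 r -> r <= C.
Proof.
move=> ach; rewrite leNgt; apply/negP => Cr.
have k0 : 0 < 3 + `|r| by rewrite ltr_wpDr.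
(* Dividing the converse by n will give (r - eps)(1 - eps) <= C + 2 eps, that is r - C <= eps (3 +
   r) - eps^2; with this [eps] the right side is at most (r - C) / 2. The cap 1/2 keeps 1 - eps
   positive. *)
pose eps : R := Num.min 2^-1 ((r - C) / (2 * (3 + `|r|))).
have e0 : 0 < eps.
  by rewrite /eps lt_min invr_gt0 ltr0n/= divr_gt0 ?mulr_gt0// subr_gt0.
have e2 : eps <= 2^-1 by rewrite /eps ge_min lexx.
have e3 : eps * (3 + `|r|) <= (r - C) / 2.
  have : eps <= (r - C) / (2 * (3 + `|r|)) by rewrite /eps ge_min lexx orbT.
  rewrite -(ler_pM2r k0) => /le_trans; apply.
  by rewrite invfM mulrA divfK// gt_eqF.
(* The lower bound on [B] makes eps n at least 1, which absorbs the constant 1 of the converse. *)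
have [N [B [M [c [N0 B0 M0 vc [hr he hl]]]]]] :=
  ach eps e0 1%N (Num.truncn eps^-1).+1.
have := code_converse M0 vc.
have n0 : 0 < (N * B)%:R :> R.
  by rewrite ltr0n muln_gt0 N0/= (leq_trans _ B0).
have ninv : 1 <= eps * (N * B)%:R.
  rewrite mulrC -ler_pdivrMr// div1r.
  apply: (@le_trans _ _ (Num.truncn eps^-1).+1%:R); first exact/ltW/truncnS_gt.
  by rewrite ler_nat (leq_trans B0)// leq_pmull.
rewrite /rate ler_pdivlMr// in hr.
rewrite ler_pdivrMr// in hl.
set l := log2 M%:R in hr *.
have l0 : 0 <= l by rewrite log2_ge0// ler1n.
set n := (N * B)%:R in hr hl n0 ninv *.
move=> h.
have h1 : l * (1 - eps) <= n * C + eps * n + eps * n.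
  have : l * (1 - eps) <= l * (1 - err_prob p1 p2 q1 qs1 c).
    by rewrite ler_wpM2l// lerB.
  lra.
have h2 : (r - eps) * n * (1 - eps) <= l * (1 - eps) by rewrite ler_wpM2r//; lra.
have h3 : (r - eps) * (1 - eps) <= C + eps + eps.
  by rewrite -(ler_pM2r n0); lra.
have h4 : eps * r <= eps * `|r| by rewrite ler_wpM2l ?(ltW e0)// ler_norm.
have h5 : 0 <= eps ^+ 2 by rewrite sqr_ge0.
lra.
Qed.


(** * Random codes and achievability *)

Section RandomCode.
Variables (N B M L : nat) (tau1 tau2 b1 b2 : R).
Hypotheses (M0 : (0 < M)%N) (L0 : (0 < L)%N) (tau1_gt0 : 0 < tau1) (tau2_gt0 : 0 < tau2).
Hypothesis typ1 : forall x : word N B,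
  \sum_(s : states B) blockP Q s * atypical (blockW pi1 s) tau1 x <= b1.
Hypothesis typ2 : forall x : word N B,
  \sum_(s : states B) blockP Q s * atypical (blockW pi2 s) tau2 x <= b2.

Let u : R := #|word N B|%:R^-1.

(** The receiver's failure bound, with all [M * L] codewords in competition, plus the
    eavesdropper's, with only the [L] codewords of a known message. *)
Definition random_coding_bound : R :=
  (b1 + (M * L).-1%:R * (u / tau1)) + (b2 + L.-1%:R * (u / tau2)).

Let W1 s : word N B -> word N B -> R := blockW pi1 s.
Let W2 s : word N B -> word N B -> R := blockW pi2 s.

Let pi1_01 c : 0 <= pi1 c <= 1.
Proof. by have := cross_main_bounds c; lra. Qed.

Let pi2_01 c : 0 <= pi2 c <= 1.
Proof. by have := cross_eve_bounds c; lra. Qed.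

Let M0R : 0 < M%:R :> R. Proof. by rewrite ltr0n. Qed.
Let L0R : 0 < L%:R :> R. Proof. by rewrite ltr0n. Qed.

Let Mi_ge0 : 0 <= M%:R^-1 :> R. Proof. by rewrite invr_ge0 ltW. Qed.
Let Li_ge0 : 0 <= L%:R^-1 :> R. Proof. by rewrite invr_ge0 ltW. Qed.

Let codebook := {ffun 'I_M * 'I_L -> word N B}.

Let main_bound (f : codebook) s : R :=
  \sum_m M%:R^-1 * \sum_l L%:R^-1 * union_bound (W1 s) tau1 f (m, l).

Let eve_bound (f : codebook) s : R :=
  \sum_m M%:R^-1 * \sum_l L%:R^-1 * union_bound (W2 s) tau2 (fun l => f (m, l)) l.

(** By linearity the codebook average moves inside those over states, messages and indices, so a
    bound for each fixed triple is enough. *)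
Let expect_bound (P : states B -> R) (U : codebook -> states B -> 'I_M -> 'I_L -> R)
    (K : states B -> R) (k : R) :
  (forall s, 0 <= P s) -> \sum_(s : states B) P s * K s <= k ->
  (forall s m l, \sum_f codebookP R f * U f s m l <= K s) ->
  \sum_f codebookP R f *
    (\sum_(s : states B) P s * \sum_m M%:R^-1 * \sum_l L%:R^-1 * U f s m l)
  <= k.
Proof.
move=> P0 PK UK; apply: le_trans PK.
under eq_bigr do rewrite mulr_sumr.
rewrite exchange_big/=; apply: ler_sum => s _.
under eq_bigr do rewrite mulrCA.
rewrite -mulr_sumr ler_wpM2l// -(sum_uniform M0 (K s)).
under eq_bigr do rewrite mulr_sumr.
rewrite exchange_big/=; apply: ler_sum => m _.
under eq_bigr do rewrite mulrCA.
rewrite -mulr_sumr ler_wpM2l// -(sum_uniform L0 (K s)).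
under eq_bigr do rewrite mulr_sumr.
rewrite exchange_big/=; apply: ler_sum => l _.
under eq_bigr do rewrite mulrCA.
by rewrite -mulr_sumr ler_wpM2l.
Qed.

Let word_gt0 : (0 < #|word N B|)%N.
Proof. by rewrite card_ffun card_bool expn_gt0. Qed.

Let expect_typ (W : states B -> word N B -> word N B -> R) (tau b k : R) :
  (forall x, \sum_(s : states B) blockP Q s * atypical (W s) tau x <= b) ->
  \sum_(s : states B) blockP Q s * (\sum_(x : word N B) u * atypical (W s) tau x + k) <= b + k.
Proof.
move=> h; under eq_bigr do rewrite mulrDr mulr_sumr.
rewrite big_split/= -mulr_suml (sum_blockP _ sum_Qstate) mul1r lerD2r.
rewrite exchange_big/= -[b]mul1r -(sum_uniform_card R word_gt0) mulr_suml.
apply: ler_sum => x _; under eq_bigr do rewrite mulrCA.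
by rewrite -mulr_sumr ler_wpM2l ?invr_ge0.
Qed.

(** The states are averaged before the codebook is chosen, as it may not depend on them. Both
    summands are nonnegative, so a bound on the sum controls each. *)
Let good_codebook : exists f : codebook,
  \sum_(s : states B) blockP Q s * main_bound f s +
  \sum_(s : states B) blockP Q s * eve_bound f s <=
  random_coding_bound.
Proof.
apply: (@exists_le_expect _ _ (@codebookP R _ _)).
- by move=> f; exact: codebookP_ge0.
- exact: sum_codebookP.
under eq_bigr do rewrite mulrDr.
rewrite big_split/= lerD//.
  apply: expect_bound (expect_typ _ typ1) _ => [s|s m l].
    exact: blockP_ge0 Qstate_ge0.
  have := @expect_union_bound R _ (W1 s) tau1 tau1_gt0
    (fun x y => blockW_ge0 s x y pi1_01) (sum_blockWl _ _) word_gt0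
    _ _ id (m, l) (@inj_id _).
  by rewrite card_prod !card_ord.
apply: expect_bound (expect_typ _ typ2) _ => [s|s m l].
  exact: blockP_ge0 Qstate_ge0.
have := @expect_union_bound R _ (W2 s) tau2 tau2_gt0
    (fun x y => blockW_ge0 s x y pi2_01) (sum_blockWl _ _) word_gt0
    ('I_M * 'I_L)%type _ (fun l => (m, l)) l.
by rewrite card_ord; apply => l1 l2 [].
Qed.

Let union_bound_ge0 (W : word N B -> word N B -> R) (tau : R) (J : finType)
    (g : J -> word N B) (j : J) :
  (forall x y, 0 <= W x y) -> 0 <= union_bound W tau g j.
Proof.
move=> W0; rewrite /union_bound /atypical addr_ge0 ?sumr_ge0// => [y _|k _].
  by rewrite mulr_ge0.
by rewrite sumr_ge0// => y _; rewrite mulr_ge0.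
Qed.

(** For the leakage, I(M;Z) = H(Z) - H(Z|M) with H(Z) at most n. Given M, the entropy of Z is the
    noise entropy plus the information on the index, which Fano's inequality puts above log L - 1 -
    (error) log L. *)
Lemma random_code : exists c : Defs.code R N B M,
  [/\ valid_code c, err_prob p1 p2 q1 qs1 c <= random_coding_bound &
      leakage ps1 ps2 q1 qs1 c <=
      (N * B)%:R * (1 - (qs1 * H2 ps1 + (1 - qs1) * H2 ps2)) - log2 L%:R + 1 +
      random_coding_bound * log2 L%:R].
Proof.
have [f fbound] := good_codebook.
have P0 (s : states B) : 0 <= blockP Q s by exact: blockP_ge0 Qstate_ge0.
have W1_0 s x y : 0 <= W1 s x y by exact: blockW_ge0.
have W2_0 s x y : 0 <= W2 s x y by exact: blockW_ge0.
have main0 : 0 <= \sum_(s : states B) blockP Q s * main_bound f s.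
  apply: sumr_ge0 => s _; rewrite mulr_ge0//; apply: sumr_ge0 => m _.
  rewrite mulr_ge0//; apply: sumr_ge0 => l _; rewrite mulr_ge0//.
  exact: union_bound_ge0.
have eve0 : 0 <= \sum_(s : states B) blockP Q s * eve_bound f s.
  apply: sumr_ge0 => s _; rewrite mulr_ge0//; apply: sumr_ge0 => m _.
  rewrite mulr_ge0//; apply: sumr_ge0 => l _; rewrite mulr_ge0//.
  exact: union_bound_ge0.
pose m0 := Ordinal M0; pose l0 := Ordinal L0.
(* Summing over [l] counts a repeated codeword with its multiplicity, so the total mass stays 1
   without injectivity of [f]. *)
pose en (m : 'I_M) (x : word N B) : R := \sum_l L%:R^-1 * (x == f (m, l))%:R.
pose c : Defs.code R N B M :=
  Code en (fun y s => (decode (W1 s) tau1 (m0, l0) f y).1).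
have vc : valid_code c.
  split=> [m x|m]; first by apply: sumr_ge0 => l _; rewrite mulr_ge0.
  rewrite /= /en exchange_big/= -[RHS](sum_uniform L0); apply: eq_bigr => l _.
  rewrite -mulr_sumr (bigD1 (f (m, l)))//= eqxx big1 ?addr0// => x.
  by move=> /negbTE ->.
have outE (W : word N B -> word N B -> R) m y :
    output (enc c m) W y = mixture (fun l => W (f (m, l))) y.
  rewrite /output /= /en; under eq_bigr do rewrite mulr_suml.
  rewrite exchange_big/=; apply: eq_bigr => l _.
  rewrite (bigD1 (f (m, l)))//= eqxx mulr1 big1 ?addr0// => x /negbTE ->.
  by rewrite mulr0 mul0r.
exists c; split=> //.
  rewrite err_probE -/Q -/pi1.
  apply: (@le_trans _ _ (\sum_(s : states B) blockP Q s * main_bound f s)); last by lra.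
  apply: ler_sum => s _; rewrite ler_wpM2l//; apply: ler_sum => m _.
  rewrite ler_wpM2l//.
  (* The decoder is charged for a wrong pair, which includes every wrong message. *)
  apply: (@le_trans _ _ (\sum_y \sum_l L%:R^-1 *
      (W1 s (f (m, l)) y * (decode (W1 s) tau1 (m0, l0) f y != (m, l))%:R))).
    apply: ler_sum => y _; rewrite outE mulr_suml; apply: ler_sum => l _.
    rewrite -mulrA ler_wpM2l// ler_wpM2l//= ler_nat.
    by case: (decode _ _ _ _ _) => m' l'; rewrite xpair_eqE; case: (m' == m).
  rewrite exchange_big/=; apply: ler_sum => l _.
  by rewrite -mulr_sumr ler_wpM2l// decode_error.
have lL : 0 <= log2 L%:R :> R by rewrite log2_ge0// ler1n.
have cardW : log2 #|word N B|%:R = (N * B)%:R :> R.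
  rewrite card_ffun card_bool card_prod !card_ord natrX -powR_mulrn// log2_powR.
  by rewrite mulnC.
have MIle s : MI_given ps1 ps2 c s <=
    (N * B)%:R - N%:R * (\sum_k H2 (pi2 (s k))) - log2 L%:R + 1 +
    eve_bound f s * log2 L%:R.
  rewrite MI_givenE//; [|by move: p1_ge0 p12 p2s1 ps12 ps2_half => *; lra..].
  have -> : (fun m => output (enc c m) (blockW pi2 s)) =
            (fun m => mixture (fun l => W2 s (f (m, l)))).
    by apply/funext => m; apply/funext => y; rewrite outE.
  have sW m : stochastic (fun l => W2 s (f (m, l))).
    by split=> [l y|l]; [exact: W2_0|exact: sum_blockW].
  have smix m : \sum_y mixture (fun l => W2 s (f (m, l))) y = 1.
    rewrite exchange_big/= -[RHS](sum_uniform L0); apply: eq_bigr => l _.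
    by rewrite -mulr_sumr sum_blockW.
  (* Knowing m, the eavesdropper decodes the random index l, so Z carries
     nearly log L bits of randomness that are useless for finding m. *)
  have nmix m : neg_entropy (mixture (fun l => W2 s (f (m, l)))) <=
     - (N%:R * (\sum_k H2 (pi2 (s k)))) - log2 L%:R + 1 +
     (\sum_l L%:R^-1 * union_bound (W2 s) tau2 (fun l => f (m, l)) l) * log2 L%:R.
    have := fano L0 (decode (W2 s) tau2 l0 (fun l => f (m, l))) (sW m).
    have -> : mutual_info (fun l => W2 s (f (m, l))) =
        - (N%:R * (\sum_k H2 (pi2 (s k)))) - neg_entropy (mixture (fun l => W2 s (f (m, l)))).
      rewrite /mutual_info; congr (_ - _).
      rewrite -[RHS](sum_uniform L0) mulr_sumr; apply: eq_bigr => l _.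
      by rewrite neg_entropy_blockW.
    set e := \sum_m _; set e' := \sum_l L%:R^-1 * union_bound _ _ _ _.
    have : e * log2 L%:R <= e' * log2 L%:R.
      rewrite ler_wpM2r//; apply: ler_sum => l _; rewrite ler_wpM2l//.
      exact: (@decode_error _ _ (W2 s) tau2 (W2_0 s) _ l0 (fun l => f (m, l)) l).
    lra.
  have : - (N * B)%:R <= neg_entropy (mixture (fun m => mixture (fun l => W2 s (f (m, l))))).
    rewrite -cardW; apply: neg_entropy_ge_uniform => [y|].
      apply: sumr_ge0 => m _; rewrite mulr_ge0//.
      by apply: sumr_ge0 => l _; rewrite mulr_ge0.
    rewrite exchange_big/= -[RHS](sum_uniform M0); apply: eq_bigr => m _.
    by rewrite -mulr_sumr smix.
  rewrite /mutual_info.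
  have : M%:R^-1 * (\sum_m neg_entropy (mixture (fun l => W2 s (f (m, l))))) <=
     - (N%:R * (\sum_k H2 (pi2 (s k)))) - log2 L%:R + 1 + eve_bound f s * log2 L%:R.
    set K := - _ - _ + 1; rewrite -(sum_uniform M0 K) mulr_sumr mulr_suml.
    rewrite -big_split/=; apply: ler_sum => m _.
    by rewrite -mulrA -mulrDr ler_wpM2l.
  lra.
have : leakage ps1 ps2 q1 qs1 c <= \sum_(s : states B) blockP Q s *
    ((N * B)%:R - N%:R * (\sum_k H2 (pi2 (s k))) - log2 L%:R + 1 +
    eve_bound f s * log2 L%:R).
  by apply: ler_sum => s _; apply: ler_wpM2l; [exact: P0|exact: MIle].
have -> : \sum_(s : states B) blockP Q s *
    ((N * B)%:R - N%:R * (\sum_k H2 (pi2 (s k))) - log2 L%:R + 1 +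
    eve_bound f s * log2 L%:R) =
    (N * B)%:R - N%:R * (B%:R * (qs1 * H2 ps1 + (1 - qs1) * H2 ps2))
    - log2 L%:R + 1 + (\sum_(s : states B) blockP Q s * eve_bound f s) * log2 L%:R.
  transitivity (\sum_(s : states B) (blockP Q s * ((N * B)%:R - log2 L%:R + 1) +
    - N%:R * (blockP Q s * (\sum_k H2 (pi2 (s k)))) +
    blockP Q s * eve_bound f s * log2 L%:R)).
    by apply: eq_bigr => s _; ring.
  rewrite !big_split/= -!mulr_suml -mulr_sumr (sum_blockP _ sum_Qstate).
  rewrite (@blockP_expect_sum R B Q (fun u => H2 (pi2 u)) sum_Qstate).
  by rewrite Qstate_cross_eve; ring.
have : (\sum_(s : states B) blockP Q s * eve_bound f s) * log2 L%:R <=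
    random_coding_bound * log2 L%:R.
  by rewrite ler_wpM2r//; lra.
rewrite natrM; lra.
Qed.

End RandomCode.

(** Write h1 and h2 for the two means. Monotonicity of [H2] gives h1 <= h2 for each state pair
    separately. With h1 <= h2 the random index alone, and with h2 <= 1 the message alone, stays
    below the receiver's rate 1 - h1. *)
Lemma capacity_bounds :
  [/\ 0 <= q1 * H2 p1 + (1 - q1) * H2 p2,
      q1 * H2 p1 + (1 - q1) * H2 p2 <= qs1 * H2 ps1 + (1 - qs1) * H2 ps2 &
      qs1 * H2 ps1 + (1 - qs1) * H2 ps2 <= 1].
Proof.
rewrite -Qstate_cross_main -Qstate_cross_eve; split.
- by apply: sumr_ge0 => c _; rewrite mulr_ge0 ?Qstate_ge0// H2_ge0 ?cross_main_bounds.
- apply: ler_sum => c _; rewrite ler_wpM2l ?Qstate_ge0//.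
  have /andP[? _] := cross_main_bounds c; have /andP[_ ?] := cross_eve_bounds c.
  by rewrite H2_homo// cross_main_le_eve.
- rewrite -[leRHS]sum_Qstate; apply: ler_sum => c _.
  by rewrite ler_piMr ?Qstate_ge0// H2_le1 ?cross_eve_bounds.
Qed.

(* The secret message has rate C - 2d and the randomization has rate
   1 - h2 - 2d, just below what the eavesdropper can decode; together they
   stay below the rate 1 - h1 decodable by the legitimate receiver. *)
Lemma achievable_capacity : achievable p1 p2 ps1 ps2 q1 qs1 C.
Proof.
move=> eps eps0 N0 B0.
set h1 := q1 * H2 p1 + (1 - q1) * H2 p2.
set h2 := qs1 * H2 ps1 + (1 - qs1) * H2 ps2.
have CE : C = h2 - h1 by rewrite /C /h1 /h2; ring.
have [h1_0 h12 h2_1] : [/\ 0 <= h1, h1 <= h2 & h2 <= 1] := capacity_bounds.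
(* The leakage per symbol will be at most 5d: 2d from the index rate, d for the 1 in Fano's
   inequality, and 2d for [eta * log2 L]. The rate loses 2d and the error is at most d. *)
pose d := eps / 8; have d0 : 0 < d by rewrite divr_gt0.
have pi1_01 c : 0 <= pi1 c <= 1 by have := cross_main_bounds c; lra.
have pi2_01 c : 0 <= pi2 c <= 1 by have := cross_eve_bounds c; lra.
pose v := 2 * info_var pi1 Q + 2 * info_var pi2 Q.
have v0 : 0 <= v.
  by rewrite addr_ge0// mulr_ge0// info_var_ge0//; exact: Qstate_ge0.
(* [K / B] will bound [eta]: the first term is Chebyshev's, the second covers four confusion terms
   of size 2^(-n d), each at most 1 / (n d ln 2) because e^x >= 1 + x. Then d B >= K + 1 gives both
   [eta <= d] and d n >= 1. *)
pose K := v / d ^+ 2 + 4 / (d * ln 2).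
have K0 : 0 <= K.
  by rewrite addr_ge0// divr_ge0// ?sqr_ge0// mulr_ge0 ?ltW// ln2_gt0.
pose N := N0.+1; pose B := maxn B0 (Num.truncn ((K + 1) / d)).+1.
have B_gt0 : (0 < B)%N by rewrite leq_max orbT.
have B_gt0R : 0 < B%:R :> R by rewrite ltr0n.
have Bbig : K + 1 <= d * B%:R.
  rewrite mulrC -ler_pdivrMr//; apply/ltW/(lt_le_trans (truncnS_gt _)).
  by rewrite ler_nat leq_maxr.
pose n : R := (N * B)%:R.
have Bn : B%:R <= n by rewrite ler_nat leq_pmull.
have n0 : 0 < n by apply: lt_le_trans Bn.
pose e (x : R) : R := 2 `^ (n * x).
have eD x y : e (x + y) = e x * e y by rewrite /e mulrDr powRD// pnatr_eq0 implybT.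
have e0 x : 0 < e x by rewrite powR_gt0.
have eM x y : x <= y -> e x <= e y by move=> xy; rewrite ler_powR ?ler1n// ler_pM2l.
have eN x : (e x)^-1 = e (- x) by rewrite /e mulrN powRN.
have lg x : log2 (e x) = n * x by exact: log2_powR.
have [m Mpred lM] : exists2 m : nat, m%:R <= e (h2 - h1 - 2 * d) &
    n * (h2 - h1 - 2 * d) <= log2 m.+1%:R by exact: exists_size.
have [l Lpred lL] : exists2 l : nat, l%:R <= e (1 - h2 - 2 * d) &
    n * (1 - h2 - 2 * d) <= log2 l.+1%:R by exact: exists_size.
have n1 : 1 <= n by rewrite ler1n muln_gt0.
have lL2 : log2 l.+1%:R <= 2 * n.
  have e1 : 2 <= e 1.
    by rewrite /e mulr1 -[leLHS]powRr1// ler_powR// ler1n.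
  have Lle : l.+1%:R <= e 1 * e 1.
    rewrite -natr1.
    have : l%:R <= e 1 by apply: le_trans Lpred _; apply: eM; lra.
    have : 2 * e 1 <= e 1 * e 1 by rewrite ler_pM2r.
    lra.
  apply: (le_trans (ler_log2 _ Lle)); first by rewrite ltr0n.
  by rewrite log2M// lg mulr1; lra.
have T_le : e (- d) <= (n * d * ln 2)^-1.
  rewrite -eN lef_pV2 ?posrE ?mulr_gt0 ?ln2_gt0//.
  rewrite /e /powR pnatr_eq0/=; apply: le_trans (expR_ge1Dx _); lra.
pose t1 := e (- (h1 + d)); pose t2 := e (- (h2 + d)).
have typ1 (x : word N B) : \sum_(s : states B) blockP Q s *
    atypical (blockW pi1 s) t1 x <= 2 * info_var pi1 Q / (B%:R * d ^+ 2).
  have := block_lln pi1_01 Qstate_ge0 sum_Qstate x (ltn0Sn N0) B_gt0 d0.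
  by rewrite Qstate_cross_main -mulrN.
have typ2 (x : word N B) : \sum_(s : states B) blockP Q s *
    atypical (blockW pi2 s) t2 x <= 2 * info_var pi2 Q / (B%:R * d ^+ 2).
  have := block_lln pi2_01 Qstate_ge0 sum_Qstate x (ltn0Sn N0) B_gt0 d0.
  by rewrite Qstate_cross_eve -mulrN.
have [c [vc errc leakc]] :=
  random_code (M := m.+1) (L := l.+1) isT isT (e0 _) (e0 _) typ1 typ2.
set eta := random_coding_bound _ _ _ _ _ _ _ _ in errc leakc.
have eta_le : eta <= d.
  have uE : #|word N B|%:R^-1 = e (- 1).
    rewrite card_ffun card_bool card_prod !card_ord natrX -powR_mulrn//.
    by rewrite -powRN /e mulrN1 mulnC.
  (* Both sizes are one above an integer part, so the competitors number m l + m + l; each of the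
     three terms has exponent at most -d, the mixed one even -3d. *)
  have c1 : (m.+1 * l.+1).-1%:R * (e (- 1) / t1) <= 3 * e (- d).
    have -> : (m.+1 * l.+1).-1%:R = m%:R * l%:R + m%:R + l%:R :> R.
      rewrite -natrM -!natrD mulnS mulSn addSn /=; congr _%:R.
      by rewrite addnA addnC addnA.
    rewrite /t1 eN opprK -eD.
    have ml : m%:R * l%:R <= e (h2 - h1 - 2 * d + (1 - h2 - 2 * d)).
      by rewrite eD ler_pM.
    have k1 : m%:R * l%:R * e (- 1 + (h1 + d)) <= e (- d).
      apply: (@le_trans _ _ (e (h2 - h1 - 2 * d + (1 - h2 - 2 * d)) * e (- 1 + (h1 + d)))).
        by rewrite ler_pM2r.
      by rewrite -eD; apply: eM; lra.
    have k2 : m%:R * e (- 1 + (h1 + d)) <= e (- d).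
      apply: (@le_trans _ _ (e (h2 - h1 - 2 * d) * e (- 1 + (h1 + d)))).
        by rewrite ler_pM2r.
      by rewrite -eD; apply: eM; lra.
    have k3 : l%:R * e (- 1 + (h1 + d)) <= e (- d).
      apply: (@le_trans _ _ (e (1 - h2 - 2 * d) * e (- 1 + (h1 + d)))).
        by rewrite ler_pM2r.
      by rewrite -eD; apply: eM; lra.
    lra.
  (* The exponent is exactly -d: of the 2d taken off the index rate, one d pays for the threshold
     and the other remains as decay. *)
  have c2 : l%:R * (e (- 1) / t2) <= e (- d).
    rewrite /t2 eN opprK -eD.
    apply: (@le_trans _ _ (e (1 - h2 - 2 * d) * e (- 1 + (h2 + d)))).
      by rewrite ler_pM2r.
    by rewrite -eD; apply: eM; lra.
  have etaE : eta <= v / (B%:R * d ^+ 2) + 4 * e (- d).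
    by rewrite /eta /random_coding_bound uE /v mulrDl; lra.
  have T_le' : 4 * e (- d) <= 4 / (d * ln 2) / B%:R.
    rewrite -mulrA ler_pM2l//; apply: le_trans T_le _.
    rewrite -invfM lef_pV2 ?posrE ?mulr_gt0 ?ln2_gt0//.
    by rewrite -[leRHS]mulrA [leLHS]mulrC ler_pM2r// mulr_gt0 ?ln2_gt0.
  have vE : v / (B%:R * d ^+ 2) = v / d ^+ 2 / B%:R by field; rewrite !gt_eqF.
  have KB : K / B%:R <= d by rewrite ler_pdivrMr//; lra.
  by move: KB; rewrite /K mulrDl; lra.
have deps : d <= eps by rewrite /d; lra.
exists N, B, m.+1, c; split => //.
- exact: leq_maxl.
split.
- rewrite /rate ler_pdivlMr// -/n CE; apply: le_trans lM.
  by rewrite mulrC ler_pM2l//; rewrite /d; lra.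
- exact: le_trans errc (le_trans eta_le deps).
- rewrite ler_pdivrMr// -/n; apply: (le_trans leakc); rewrite -/n -/h2.
  have dn : 1 <= d * n.
    apply: (@le_trans _ _ (d * B%:R)); last by rewrite ler_pM2l.
    by apply: le_trans Bbig; rewrite lerDr.
  have lL0 : 0 <= log2 l.+1%:R :> R by rewrite log2_ge0// ler1n.
  have e1 : eta * log2 l.+1%:R <= d * (2 * n).
    apply: (@le_trans _ _ (d * log2 l.+1%:R)); first by rewrite ler_wpM2r.
    by rewrite ler_pM2l.
  have -> : eps = 8 * d by rewrite /d; field.
  lra.
Qed.

End WiretapChannel.

Theorem theorem3 (R : realType) (p1 p2 ps1 ps2 q1 qs1 : R) :
  0 <= q1 <= 1 -> 0 <= qs1 <= 1 ->
  0 <= p1 -> p1 <= p2 -> p2 <= ps1 -> ps1 <= ps2 -> ps2 <= 2^-1 ->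
  is_secrecy_capacity p1 p2 ps1 ps2 q1 qs1
    (qs1 * H2 ps1 + (1 - qs1) * H2 ps2 - q1 * H2 p1 - (1 - q1) * H2 p2).
Proof.
move=> q1_01 qs1_01 p1_0 p12 p2s1 ps12 ps2_2; split.
  by move=> r; exact: achievable_le.
by move=> C' C'ub; apply: C'ub; exact: achievable_capacity.
Qed.
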